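(* There is a constant $C>0$ such that for all integers $r\geq 2$, in every $r$-connected graph $G$, any two longest cycles $C_1,C_2$ of $G$ satisfy $|V(C_1)\cap V(C_2)|\geq C r^{5/8}$.
   Context: A longest cycle in a graph is a cycle of maximum possible length among all cycles in the graph. Graphs are finite. *)

(* Defs.v *)
From mathcomp Require Import all_boot.

Set Implicit Arguments.
Unset Strict Implicit.
Unset Printing Implicit Defensive.

Definition simple_graph (T : finType) (e : rel T) : Prop :=
  symmetric e /\ irreflexive e.

(* Adjacency in G - S, keeping T as the carrier: the vertices of S become
   isolated, so only vertices outside S are relevant. *)
Definition del_rel (T : finType) (e : rel T) (S : {set T}) : rel T :=
  fun x y => [&& x \notin S, y \notin S & e x y].

(* More than r vertices, and no set of fewer than r vertices separates the
   graph; in particular the complete graph on r + 1 vertices is r-connected. *)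
Definition r_connected (r : nat) (T : finType) (e : rel T) : Prop :=
  r < #|T| /\
  forall S : {set T}, #|S| < r ->
    forall x y : T, x \notin S -> y \notin S -> connect (del_rel e S) x y.

(* A cycle is listed by its vertices in cyclic order; its length is the size of
   the list. Without the bound on the size, ucycle would accept the empty list
   and a single edge traversed back and forth. *)
Definition is_cycle (T : finType) (e : rel T) (c : seq T) : Prop :=
  2 < size c /\ ucycle e c.

Definition longest_cycle (T : finType) (e : rel T) (c : seq T) : Prop :=
  is_cycle e c /\ forall c' : seq T, is_cycle e c' -> size c' <= size c.

(* Main.v *)
(* Cut two longest cycles C1 and C2 at their m common vertices into segments. By Menger's
   theorem at least r - m disjoint paths run from C1 to C2 off the common vertices; regard them as
   the edges of a bipartite graph H between the segments of C1 and those of C2. A closed walk of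
   length 2k in H through distinct segments allows an exchange: D1 arises from C1 by replacing its
   k arcs along the walk by the k arcs of C2 and the 2k paths, and D2 arises from C2 in the same
   way. As |D1| + |D2| > |C1| + |C2|, the graphs D1 and D2 cannot both be single cycles, and
   whether they are depends only on the orders in which the ends of the paths occur on C1 and C2.
   For k = 1 this says that H is simple, and for k = 2 that the orders in a quadrilateral of H
   disagree on C1 or on C2. Given an edge xy of H, sort the edges ab for which x, a, b, y form a
   quadrilateral into 16 classes by the orders at x, y, a and b. By the case k = 2 a class has
   no 4-cycle, and by the cases k = 3 and k = 4, through a finite check of all orders, it has no
   6-cycle. So xy lies in O((d_x d_y)^(2/3) + d_x + d_y) quadrilaterals, and counting the
   quadrilaterals with weight (d_x d_y d_a d_b)^(-1/3) by Cauchy-Schwarz gives e(H) = O(m^(8/5)),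
   hence r = O(m^(8/5)). *)
Require Import Defs.
From mathcomp Require Import all_boot all_order all_algebra.
From mathcomp Require Import zify ring lra boolp.
From mathcomp Require Import reals exp.

(** All exchanged arcs lie inside segments, hence away from the common vertices; so an arc brought
    over from the other cycle meets nothing that was there before. What C1 loses is what C2 gains,
    and conversely, except that the ends of the paths stay on their own cycle and also enter the
    other one: this is the strict gain.

    In a 6-cycle of one class, the class fixes how the edge xy is ordered against the other paths,
    and the case k = 2 makes every remaining order at a vertex of the 6-cycle the reverse of the one
    at x or at y. Only the orders of three paths at x and at y and of four segments on each cycle
    stay open, which makes the check finite.

    The exponent -1/3 cancels the main term (d_x d_y)^(2/3): every edge then contributes O(1), and
    the weighted number of quadrilaterals is O(e) up to a secondary term. Cauchy-Schwarz bounds it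
    below by e^4 / T^4, where T = (n^2 e)^(1/3) bounds the sum of the cube roots of the degrees and
    n is the number of segments of a cycle. So e^9 = O(T^12) = O(n^8 e^4), whence the exponent
    8/5. *)

Set Implicit Arguments.
Unset Strict Implicit.
Unset Printing Implicit Defensive.

(** * Rerouting a cycle *)

(* The marks [os] are listed in the order in which they occur on a cycle. The arcs from
   [os_2m] to [os_2m+1] are dropped, the others are kept, and connectors join mark [i] to mark
   [mate i]. [single_cycle] says that following kept arcs and connectors alternately visits all
   of them. *)
Section Traversal.
Variables (k : nat) (os : seq nat).

Definition mate i := if odd i then i.-1 else i.+1.
Definition cross i :=
  let q := index i os in
  nth 0 os ((if odd q then q.+1 else q + (k.*2).-1) %% k.*2).
Definition arc_index i :=
  let q := index i os in if odd q then q./2 else (q./2 + k.-1) %% k.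
Definition next_start i := mate (cross i).
Definition starts := traject next_start (nth 0 os 1) k.
Definition single_cycle :=
  [&& perm_eq (map arc_index starts) (iota 0 k),
      perm_eq [seq (cross i)./2 | i <- starts] (iota 0 k)
    & fcycle next_start starts].
End Traversal.

Lemma mateK : involutive mate.
Proof. by rewrite /mate; case=> [|i] //=; case hi: (odd i); rewrite /= ?hi. Qed.

Lemma mate_double j : mate j.*2 = j.*2.+1.
Proof. by rewrite /mate odd_double. Qed.

Lemma mate_lt k i : i < k.*2 -> mate i < k.*2.
Proof. by rewrite /mate; case: ifP; lia. Qed.

Section Gaps.
Variable T : eqType.

(* The gap after the last mark is chosen cyclically, so it wraps around the end of [c]. *)
Lemma subseq_gaps (x0 : T) (ms c : seq T) : ms != [::] -> uniq c -> subseq ms c ->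
  exists n (g : nat -> seq T),
    rot n c = flatten [seq nth x0 ms q :: g q | q <- iota 0 (size ms)] /\
    forall q, q.+1 < size ms ->
      index (nth x0 ms q.+1) c = index (nth x0 ms q) c + (size (g q)).+1.
Proof.
move=> ms0 uc sub.
suff [p [g [-> hg]]] : exists p (g : nat -> seq T),
    c = p ++ flatten [seq nth x0 ms q :: g q | q <- iota 0 (size ms)] /\
    forall q, q.+1 < size ms ->
      index (nth x0 ms q.+1) c = index (nth x0 ms q) c + (size (g q)).+1.
  case: ms ms0 g hg {sub uc} => // m ms _ g hg.
  exists (size p), (fun q => if q == size ms then g q ++ p else g q); split.
    rewrite rot_size_cat [size (m :: ms)]/= -addn1 iotaD !map_cat !flatten_cat /=.
    rewrite !cats0 add0n eqxx -catA /=; congr (_ ++ _).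
    congr flatten; apply/eq_in_map => q; rewrite mem_iota add0n => /andP[_ hq].
    by rewrite (ltn_eqF hq).
  by move=> q hq; rewrite hg // ltn_eqF.
elim: ms c {ms0} uc sub => [|m ms IH] c uc sub.
  by exists c, (fun=> [::]); rewrite cats0.
have mc : m \in c by apply: (mem_subseq sub); rewrite inE eqxx.
case/splitPr: mc uc sub => p1 p2 uc sub.
have {sub} sub : subseq ms p2.
  have [_] : m \notin p1 /\ m \notin p2.
    by move: uc; rewrite cat_uniq /= => /and3P[_ /norP[-> _] /andP[-> _]].
  elim: p1 uc sub => [|a p1 IHp] //=; first by rewrite eqxx.
  move=> /andP[ha uc]; case: eqP => [hm|_]; last exact: IHp.
  by rewrite -hm mem_cat inE eqxx orbT in ha.
have [uc2 disj] : uniq p2 /\ {in m :: p2, forall z, z \notin p1}.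
  move: uc; rewrite cat_uniq cons_uniq => /and3P[_ h /andP[_ u2]]; split=> // z hz.
  by apply: contra h => hz1; apply/hasP; exists z.
have mp2 : m \notin p2 by move: uc; rewrite cat_uniq /= => /and3P[_ _ /andP[]].
have [p [g [e hg]]] := IH _ uc2 sub.
have idx z : z \in p2 -> index z (p1 ++ m :: p2) = size p1 + (index z p2).+1.
  move=> hz; rewrite index_cat (negPf (disj _ _)) ?inE ?hz ?orbT //=.
  by case: eqP hz mp2 => // ->  ->.
exists p1, (fun q => if q is q'.+1 then g q' else p); split.
  congr (_ ++ _); rewrite /= e; congr (_ :: _ ++ _); congr flatten.
  by rewrite -[1]addn0 iotaDl -map_comp.
case=> [|q] /=.
  case: ms e sub {IH hg} => // m' ms /= e sub _.
  rewrite idx ?(mem_subseq sub) ?inE ?eqxx //.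
  rewrite index_cat (negPf (disj _ _)) ?inE ?eqxx //= eqxx addn0; congr (_ + _.+1).
  have: m' \notin p.
    by move: uc2; rewrite e cat_uniq => /and3P[_ /= /norP[]].
  by rewrite e index_cat => /negPf-> /=; rewrite eqxx addn0.
rewrite ltnS => hq; rewrite !idx ?(mem_subseq sub) ?mem_nth //; try exact: ltnW.
by rewrite hg //; lia.
Qed.

Lemma cycle_blocks (e : rel T) N (mq : nat -> T) (g : nat -> seq T) :
  cycle e (flatten [seq mq q :: g q | q <- iota 0 N]) ->
  forall q, q < N -> path e (mq q) (rcons (g q) (mq (q.+1 %% N))).
Proof.
move=> cyc q qN.
have -> : N = q + (N - q.+1).+1 by lia.
move: cyc; have -> : iota 0 N = iota 0 q ++ q :: iota q.+1 (N - q.+1).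
  by rewrite -[q :: _]/(iota q (N - q.+1).+1) -iotaD; congr iota; lia.
rewrite map_cat flatten_cat cycle_catC /= -catA.
set R := flatten _ ++ flatten _; rewrite rcons_cat cat_path => /andP[p1].
suff [r ->] : exists r, rcons R (mq q) = mq (q.+1 %% (q + (N - q.+1).+1)) :: r.
  by rewrite rcons_path p1 => /andP[].
rewrite /R; case: (ltngtP q.+1 N) qN => // hq _; last first.
  rewrite -hq subnn addn1 modnn /=; case: q {p1 R hq} => [|q] /=; first by exists [::].
  by eexists.
rewrite modn_small; last by lia.
have -> : N - q.+1 = (N - q.+2).+1 by lia.
by eexists.
Qed.

End Gaps.

Section Assemble.
Variables (T : eqType) (e : rel T) (esym : symmetric e).

Lemma path_rev_sym x s y : path e x (rcons s y) -> path e y (rcons (rev s) x).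
Proof.
have := rev_path e x (rcons s y); rewrite last_rcons belast_rcons rev_cons => ->.
by rewrite (eq_path (e' := e)) // => a b; rewrite esym.
Qed.

Lemma cycle_flatten (I : eqType) (f : I -> T) (p : I -> seq T) (nx : I -> I) s :
  (forall i, i \in s -> path e (f i) (rcons (p i) (f (nx i)))) ->
  fcycle nx s -> cycle e (flatten [seq f i :: p i | i <- s]).
Proof.
case: s => [|i0 s] //= h.
rewrite rcons_cat.
suff gen l i : i \in i0 :: s -> {subset l <= i0 :: s} -> fpath nx i (rcons l i0) ->
    path e (f i) (p i ++ rcons (flatten [seq f i :: p i | i <- l]) (f i0)).
  by apply: gen; [rewrite inE eqxx|move=> z hz; rewrite inE hz orbT].
elim: l i => [|j l IH] i hi hs /=.
  by rewrite andbT => /eqP <-; rewrite cats1 h.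
case/andP=> /eqP ni pj; have := h _ hi; rewrite -cats1 ni !cat_path /= => /and3P[-> -> _] /=.
rewrite rcons_cat; apply: IH => //; first by apply: hs; rewrite inE eqxx.
by move=> z hz; apply: hs; rewrite inE hz orbT.
Qed.
End Assemble.

Lemma sum_double F n :
  \sum_(q <- iota 0 n.*2) F q = \sum_(m <- iota 0 n) (F m.*2 + F m.*2.+1).
Proof.
elim: n => [|n IH]; first by rewrite !big_nil.
have -> : iota 0 n.+1.*2 = iota 0 n.*2 ++ [:: n.*2; n.*2.+1].
  by rewrite doubleS -addn2 iotaD.
have -> : iota 0 n.+1 = iota 0 n ++ [:: n] by rewrite -addn1 iotaD.
by rewrite !big_cat IH !big_cons !big_nil /= !addn0.
Qed.

(** Both sides locate the kept arc before an even mark [q]: on the left from its index, on the right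
    as the position before [q]. For [q = 0] it is the arc wrapping around the end. *)
Lemma prev_double k q : 0 < k -> q < k.*2 -> ~~ odd q ->
  ((q./2 + k.-1) %% k).*2.+1 = (q + (k.*2).-1) %% k.*2.
Proof.
move=> k0 hq hodd; have := odd_double_half q; rewrite (negPf hodd) add0n.
move: q./2 => m mE; rewrite -{}mE in hq *; case: m hq => [|m] hq.
  by rewrite !add0n !modn_small; lia.
have -> : m.+1 + k.-1 = m + k by lia.
have -> : m.+1.*2 + (k.*2).-1 = m.*2.+1 + k.*2 by lia.
by rewrite !modnDr !modn_small; lia.
Qed.

Section Reroute.
Variables (T : eqType) (e : rel T) (esym : symmetric e).
Variables (c : seq T) (k : nat) (os : seq nat) (mk : nat -> T) (cn : nat -> seq T).
Hypotheses (k_gt0 : 0 < k) (uc : uniq c) (cyc : cycle e c).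
Hypotheses (os_perm : perm_eq os (iota 0 k.*2)) (os_sub : subseq (map mk os) c).
Hypothesis cn_path : forall i, i < k.*2 -> path e (mk i) (rcons (cn i) (mk (mate i))).
Hypothesis cn_mate : forall i, i < k.*2 -> cn (mate i) = rev (cn i).
Hypothesis single : single_cycle k os.

Let sos : size os = k.*2.
Proof. by rewrite (perm_size os_perm) size_iota. Qed.

Let uos : uniq os.
Proof. by rewrite (perm_uniq os_perm) iota_uniq. Qed.

Let mem_os i : (i \in os) = (i < k.*2).
Proof. by rewrite (perm_mem os_perm) mem_iota. Qed.

Let nth_lt q : q < k.*2 -> nth 0 os q < k.*2.
Proof. by move=> h; rewrite -mem_os mem_nth ?sos. Qed.

Let cross_lt i : cross k os i < k.*2.
Proof. by rewrite /cross nth_lt // ltn_pmod //; lia. Qed.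

Let starts_lt i : i \in starts k os -> i < k.*2.
Proof.
case/trajectP => n _ ->; case: n => [|n]; first by rewrite nth_lt //; lia.
by rewrite iterS; apply/mate_lt/cross_lt.
Qed.

(** The count is an equality of multisets: one-point predicates will show that [D] repeats no
    vertex, and [predT] gives its length. Dropped gaps start at even marks, so none wraps around the
    end of [c] and each length is a difference of indices. *)
Lemma reroute : exists D (g : nat -> seq T),
  [/\ cycle e D,
      forall P, count P D + \sum_(m <- iota 0 k) count P (g m) =
        count P c + \sum_(j <- iota 0 k) count P (cn j.*2)
    & forall m, m < k -> index (mk (nth 0 os m.*2.+1)) c =
        index (mk (nth 0 os m.*2)) c + (size (g m)).+1].
Proof.
have ms0 : map mk os != [::] by rewrite -size_eq0 size_map sos; lia.
have [n [g [rc hg]]] := subseq_gaps (mk 0) ms0 uc os_sub.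
have nthE q : nth (mk 0) (map mk os) q = mk (nth 0 os q).
  have [h|h] := ltnP q (size os); first by rewrite (nth_map 0).
  by rewrite !nth_default ?size_map.
have {}rc : rot n c = flatten [seq mk (nth 0 os q) :: g q | q <- iota 0 k.*2].
  by rewrite rc size_map sos; congr flatten; apply: eq_map => q; rewrite nthE.
have gp q : q < k.*2 -> path e (mk (nth 0 os q)) (rcons (g q) (mk (nth 0 os (q.+1 %% k.*2)))).
  by apply: (cycle_blocks (mq := fun q => mk (nth 0 os q))); rewrite -rc rot_cycle.
(* The interior of the kept arc at mark [i], read starting from [i], hence reversed if [i] is its
   far end. *)
pose da i := let q := index i os in
  if odd q then g q else rev (g ((q + (k.*2).-1) %% k.*2)).
have k2 : 0 < k.*2 by lia.
have prevS q : q < k.*2 -> ((q + (k.*2).-1) %% k.*2).+1 %% k.*2 = q.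
  move=> hq; rewrite -addn1 modnDml -addnA addn1 prednK // modnDr modn_small //.
have dap i : i < k.*2 -> path e (mk i) (rcons (da i) (mk (cross k os i))).
  move=> hi; have hq : index i os < k.*2 by rewrite -sos index_mem mem_os.
  have ni : nth 0 os (index i os) = i by rewrite nth_index ?mem_os.
  rewrite /da /cross; case: ifP => hodd; first by have := gp _ hq; rewrite ni.
  apply: path_rev_sym => //.
  by have := gp _ (ltn_pmod (index i os + (k.*2).-1) k2); rewrite prevS // ni.
pose blk i := da i ++ mk (cross k os i) :: cn (cross k os i).
have [perm1 perm2 fc] := and3P single.
exists (flatten [seq mk i :: blk i | i <- starts k os]), (fun m => g m.*2); split.
- apply: cycle_flatten fc => i /starts_lt hi.
  rewrite /blk rcons_cat cat_path; have := dap _ hi; rewrite rcons_path => /andP[-> he] /=.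
  by rewrite he; apply/cn_path/cross_lt.
- move=> P.
  (* Kept arc [m] counted with both of its marks. By [perm1] and [perm2] the traversal meets every
     kept arc and every connector once. *)
  pose G m := P (mk (nth 0 os m.*2.+1)) + (count P (g m.*2.+1) + P (mk (nth 0 os (m.*2.+2 %% k.*2)))).
  have -> : count P (flatten [seq mk i :: blk i | i <- starts k os]) =
      \sum_(m <- iota 0 k) G m + \sum_(j <- iota 0 k) count P (cn j.*2).
    rewrite -(perm_big _ perm1) -(perm_big _ perm2) !big_map -big_split /=.
    rewrite count_flatten sumnE !big_map /=; apply: eq_big_seq => i /starts_lt hi.
    rewrite count_cat /= addnA [X in _ = _ + X](_ : _ = count P (cn (cross k os i))); last first.
      have hc := cross_lt i; rewrite -[in RHS](odd_double_half (cross k os i)).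
      case hodd : (odd _); rewrite ?add0n //.
      have hm : (cross k os i)./2.*2 < k.*2 by rewrite ltn_double ltn_half_double.
      by rewrite add1n -[X in cn X.+1](mateK) -count_rev -cn_mate ?mateK // /mate /= odd_double.
    rewrite [LHS](_ : _ = P (mk i) + (count P (da i) + P (mk (cross k os i))) +
      count P (cn (cross k os i))); last by rewrite !addnA.
    congr (_ + _).
    rewrite /G /da /arc_index /cross; set q := index i os.
    have hq : q < k.*2 by rewrite -sos index_mem mem_os.
    have ni : nth 0 os q = i by rewrite nth_index ?mem_os.
    case: ifP => hodd.
      have -> : q./2.*2.+1 = q by rewrite -[in RHS](odd_double_half q) hodd.
      by rewrite ni.
    have e1 := prev_double k_gt0 hq (negbT hodd).
    rewrite -[_.*2.+2]/(_.*2.+1.+1) e1 prevS // ni count_rev.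
    by rewrite addnC -addnA addnCA.
  have -> : count P c = \sum_(q <- iota 0 k.*2) (P (mk (nth 0 os q)) + count P (g q)).
    have -> : count P c = count P (rot n c) by apply/permP; rewrite perm_sym perm_rot.
    by rewrite rc count_flatten sumnE !big_map.
  rewrite sum_double addnAC; congr (_ + _).
  rewrite -big_split /= /G.
  have shift : \sum_(m <- iota 0 k) nat_of_bool (P (mk (nth 0 os (m.*2.+2 %% k.*2)))) =
      \sum_(m <- iota 0 k) nat_of_bool (P (mk (nth 0 os m.*2))).
    case: k k_gt0 => // k' _.
    rewrite [LHS](_ : _ = \sum_(m <- iota 0 k'.+1) (P (mk (nth 0 os ((m.+1 %% k'.+1).*2))))); last first.
      by apply: eq_bigr => m _; rewrite -doubleS -!muln2 muln_modl.
    have iE : iota 0 k'.+1 = iota 0 k' ++ [:: k'] by rewrite -[k'.+1]addn1 iotaD.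
    rewrite [in LHS]iE big_cat /= big_cons big_nil addn0 modnn addnC.
    rewrite big_cons; congr (_ + _).
    rewrite -[1]addn0 iotaDl big_map; apply: eq_big_seq => m; rewrite mem_iota => /andP[_ hm].
    by rewrite add1n modn_small // addn1 ltnS; lia.
  rewrite [LHS](_ : _ = \sum_(m <- iota 0 k)
      (P (mk (nth 0 os m.*2.+1)) + count P (g m.*2.+1) + count P (g m.*2)) +
      \sum_(m <- iota 0 k) nat_of_bool (P (mk (nth 0 os (m.*2.+2 %% k.*2))))).
    by rewrite shift -big_split; apply: eq_bigr => m _ /=; clear; lia.
  by rewrite -big_split; apply: eq_bigr => m _ /=; clear; lia.
- by move=> m hm; rewrite -!nthE hg // size_map sos -doubleS leq_double.
Qed.
End Reroute.

Lemma uniq_flatten_map (I T : eqType) (f : I -> seq T) (s : seq I) :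
  uniq s -> {in s, forall i, uniq (f i)} ->
  (forall i j v, i \in s -> j \in s -> v \in f i -> v \in f j -> i = j) ->
  uniq (flatten [seq f i | i <- s]).
Proof.
elim: s => //= i s IH /andP[his us] uf disj.
rewrite cat_uniq uf ?inE ?eqxx // IH //= ?andbT.
- apply/hasPn => v /flattenP[_ /mapP[j js ->] vj]; apply/negP => vi.
  by move: his; rewrite (disj i j v) ?inE ?eqxx ?js ?orbT.
- by move=> j js; apply: uf; rewrite inE js orbT.
- by move=> j j' v js js'; apply: disj; rewrite inE ?js ?js' orbT.
Qed.

(** * Arcs of a list and the segments between common vertices *)

Section Arcs.
Variable T : eqType.
Implicit Types (c : seq T) (u v z : T).

(* One of the two truncated differences is 0. *)
Definition dist c u v := (index u c - index v c) + (index v c - index u c).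

Definition slice c p q := take (q - p).+1 (drop p c).

Definition arc_walk c u v :=
  if index u c <= index v c then slice c (index u c) (index v c)
  else rev (slice c (index v c) (index u c)).

Lemma arc_walkC c u v : u \in c -> v \in c -> arc_walk c v u = rev (arc_walk c u v).
Proof.
move=> uc vc; rewrite /arc_walk; case: ltngtP => h; rewrite ?revK //.
by rewrite h /slice subnn; case: (drop _ _) => //= a s; rewrite take0.
Qed.

Lemma slice_last x0 c p q : p <= q < size c -> exists s, slice c p q = rcons s (nth x0 c q).
Proof.
move=> /andP[pq qc]; exists (take (q - p) (drop p c)).
by rewrite /slice (take_nth x0) ?size_drop ?ltn_sub2r // ?nth_drop ?subnKC //; lia.
Qed.

Lemma mem_slice c p q z : uniq c -> p <= q < size c ->
  (z \in slice c p q) = (z \in c) && (p <= index z c <= q).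
Proof.
move=> uc /andP[pq qc]; apply/idP/idP.
  move=> hz; have zc : z \in c by apply: mem_drop (mem_take hz).
  have zd := mem_take hz.
  move: (hz); rewrite in_take_leq; last by rewrite size_drop; lia.
  rewrite zc /= => h1.
  have pz : p <= index z c.
    rewrite leqNgt; apply/negP => h.
    have zt : z \in take p c by rewrite in_take_leq //; lia.
    move: uc; rewrite -{1}(cat_take_drop p c) cat_uniq => /and3P[_ /hasPn/(_ _ zd)].
    by rewrite zt.
  rewrite pz; move: h1; have -> : index z c = p + index z (drop p c).
    rewrite -{1}(cat_take_drop p c) index_cat ifN ?size_takel //; first by lia.
    by rewrite in_take_leq; lia.
  by lia.
move=> /and3P[zc pz zq]; rewrite in_take_leq; last by rewrite size_drop; lia.
have : index z c = p + index z (drop p c).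
  rewrite -{1}(cat_take_drop p c) index_cat ifN ?size_takel //; first by lia.
  by rewrite in_take_leq; lia.
lia.
Qed.

Lemma size_arc_walk c u v : u \in c -> v \in c -> size (arc_walk c u v) = (dist c u v).+1.
Proof.
rewrite -!index_mem /arc_walk /dist /slice => hu hv.
by case: ifP => h; rewrite ?size_rev size_takel ?size_drop; lia.
Qed.

Lemma arc_walk_uniq c u v : uniq c -> uniq (arc_walk c u v).
Proof.
by move=> uc; rewrite /arc_walk /slice; case: ifP => _; rewrite ?rev_uniq take_uniq ?drop_uniq.
Qed.

Lemma mem_arc_walk c u v z : uniq c -> u \in c -> v \in c ->
  (z \in arc_walk c u v) = (z \in c) &&
    ((index u c <= index z c <= index v c) || (index v c <= index z c <= index u c)).
Proof.
move=> uc hu hv; rewrite /arc_walk.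
have [su sv] : index u c < size c /\ index v c < size c by rewrite !index_mem.
case: ifP => h; rewrite ?mem_rev mem_slice //; try congr (_ && _); lia.
Qed.

Lemma arc_walk_path (e : rel T) c u v x y : symmetric e -> sorted e c -> u \in c -> v \in c ->
  e x u -> e v y -> path e x (rcons (arc_walk c u v) y).
Proof.
move=> esym ce.
suff gen x' y' u' v' : u' \in c -> v' \in c -> index u' c <= index v' c ->
    e x' u' -> e v' y' -> path e x' (rcons (slice c (index u' c) (index v' c)) y').
  move=> uc vc xu vy; rewrite /arc_walk; case: ifP => h; first exact: gen.
  apply: path_rev_sym => //; apply: gen => //; rewrite 1?esym //; lia.
move=> uc vc h xu vy.
have hs : sorted e (slice c (index u' c) (index v' c)).
  by rewrite /slice; apply: take_sorted; apply: drop_sorted.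
have [|s es] := @slice_last u' c (index u' c) (index v' c); first by rewrite h index_mem.
have ew : slice c (index u' c) (index v' c) =
    u' :: take (index v' c - index u' c) (drop (index u' c).+1 c).
  by rewrite /slice drop_index.
have el : last u' (slice c (index u' c) (index v' c)) = v' by rewrite es last_rcons nth_index.
move: hs el; rewrite ew /= => hs el.
by rewrite xu rcons_path hs el.
Qed.

End Arcs.

Lemma sorted_index_subseq (T : eqType) (c ms : seq T) :
  uniq c -> {subset ms <= c} ->
  sorted (fun u v => index u c < index v c) ms -> subseq ms c.
Proof.
move=> uc sub srt; set r := fun u v => index u c < index v c in srt.
have tr : transitive r by move=> ? ? ?; apply: ltn_trans.
have ir : irreflexive r by move=> ?; rewrite /r ltnn.
suff -> : ms = [seq z <- c | z \in ms] by apply: filter_subseq.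
apply: (irr_sorted_eq tr ir) => //; last first.
  by move=> z; rewrite mem_filter; case h: (z \in ms) => //=; rewrite sub.
apply: sorted_filter => //.
case: c uc {sub srt} @r tr ir => // x0 s uc r tr ir.
apply/(sortedP x0) => i hi; rewrite /r !index_uniq //; exact: ltnW.
Qed.

Section Segments.
Variables (T : eqType) (c c' : seq T).
Hypothesis uc : uniq c.

(* The points of [c'] on [c] cut the list [c] into segments, numbered from 0. *)
Definition seg v := count (mem c') (take (index v c) c).

Lemma seg_le u v : index u c <= index v c -> seg u <= seg v.
Proof.
move=> h; rewrite /seg -(take_takel c h).
by rewrite -{2}(cat_take_drop (index u c) (take (index v c) c)) count_cat leq_addr.
Qed.

Lemma seg_lt z v : z \in c -> z \in c' -> index z c < index v c -> seg z < seg v.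
Proof.
move=> zc zc' h; rewrite /seg -(cat_take_drop (index z c).+1 (take (index v c) c)).
rewrite take_takel // count_cat (take_nth z) ?index_mem // nth_index // -cats1 count_cat /=.
by rewrite zc'; lia.
Qed.

Lemma seg_ltW u v : seg u < seg v -> index u c < index v c.
Proof. by rewrite !ltnNge; apply/contra/seg_le. Qed.

(** A common vertex on the arc would raise [seg] between it and the later end. *)
Lemma seg_arc u v z : u \in c -> v \in c -> u \notin c' -> v \notin c' -> seg u = seg v ->
  z \in arc_walk c u v -> z \in c /\ seg z = seg u /\ z \notin c'.
Proof.
move=> hu hv hu' hv' euv; rewrite mem_arc_walk // => /andP[zc hz]; split=> //.
wlog h : u v hu hv hu' hv' euv hz / index u c <= index z c <= index v c.
  move=> W; case/orP: hz => hz; first by apply: (W u v) => //; rewrite hz.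
  by rewrite euv; apply: (W v u) => //; rewrite hz.
have /andP[h1 h2] := h.
have ez : seg z = seg u by apply/eqP; rewrite eqn_leq (seg_le h1) euv (seg_le h2).
split=> //; apply/negP => zc'.
have zv : index z c != index v c.
  by apply: contra hv' => /eqP/(congr1 (nth u c)); rewrite !nth_index // => <-.
by have := @seg_lt z v zc zc'; rewrite ez euv ltnn => /(_ _)/negP[] //; rewrite ltn_neqAle zv.
Qed.

End Segments.

(* The ends of the paths of an exchange are numbered cyclically so that ends 2j and 2j + 1 lie in
   the same segment of one cycle, and ends 2j - 1 and 2j in the same segment of the other. *)
Definition prev_end k j := if j is j'.+1 then j'.*2.+1 else (k.*2).-1.

(** The two ends in one segment are neighbours in the order of all ends, so an order of the segments
    and one bit per segment determine that order. *)
Definition block_order k (so : seq nat) (bt : nat -> bool) :=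
  flatten [seq [:: if bt j then prev_end k j else j.*2; if bt j then j.*2 else prev_end k j]
    | j <- so].

Lemma nth_flatten_pairs (f g : nat -> nat) s m : m < size s ->
  nth 0 (flatten [seq [:: f j; g j] | j <- s]) m.*2 = f (nth 0 s m) /\
  nth 0 (flatten [seq [:: f j; g j] | j <- s]) m.*2.+1 = g (nth 0 s m).
Proof. by elim: s m => // j s IH [|m] //= /IH. Qed.

Lemma sum_prev_end k (F : nat -> nat) :
  \sum_(j <- iota 0 k) F (prev_end k j) = \sum_(j <- iota 0 k) F j.*2.+1.
Proof.
case: k => [|k]; first by rewrite !big_nil.
have iE : iota 0 k.+1 = iota 0 k ++ [:: k] by rewrite -addn1 iotaD.
have -> : \sum_(j <- iota 0 k.+1) F j.*2.+1 = \sum_(j <- iota 0 k) F j.*2.+1 + F k.*2.+1.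
  by rewrite iE big_cat /= big_cons big_nil addn0.
rewrite /= big_cons addnC; congr (_ + _).
by rewrite (iotaDl 1 0) big_map.
Qed.

Lemma block_order_perm k so bt : perm_eq so (iota 0 k) ->
  perm_eq (block_order k so bt) (iota 0 k.*2).
Proof.
move=> pso; apply/permP => P.
rewrite /block_order count_flatten sumnE !big_map (perm_big _ pso) /=.
have -> : count P (iota 0 k.*2) = \sum_(q <- iota 0 k.*2) nat_of_bool (P q).
  by rewrite -sumn_count sumnE big_map.
rewrite sum_double [RHS]big_split /=.
rewrite -(sum_prev_end k (fun q => nat_of_bool (P q))) -big_split /=.
by apply: eq_bigr => j _; case: (bt j); rewrite addn0 // addnC.
Qed.

(** * Exchanging arcs of two linked cycles *)

Record linkage (T : eqType) (e : rel T) (c c' : seq T) (I : eqType)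
    (a b : I -> T) (mid : I -> seq T) : Prop := Linkage {
  link_path : forall i, path e (a i) (rcons (mid i) (b i));
  link_src : forall i, a i \in c /\ a i \notin c';
  link_dst : forall i, b i \in c' /\ b i \notin c;
  link_mid : forall i v, v \in mid i -> v \notin c /\ v \notin c';
  link_uniq : forall i, uniq (mid i);
  link_src_inj : injective a;
  link_dst_inj : injective b;
  link_disj : forall i j v, v \in mid i -> v \in mid j -> i = j }.

Lemma linkage_sym (T : eqType) (e : rel T) (c c' : seq T) (I : eqType) (a b : I -> T) mid :
  symmetric e -> linkage e c c' a b mid -> linkage e c' c b a (fun i => rev (mid i)).
Proof.
move=> esym [h1 h2 h3 h4 h5 h6 h7 h8]; split=> //.
- by move=> i; apply: path_rev_sym.
- by move=> i v; rewrite mem_rev => /h4[].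
- by move=> i; rewrite rev_uniq.
- by move=> i j v; rewrite !mem_rev; apply: h8.
Qed.

Section HalfExchange.
Variables (T : eqType) (e : rel T) (c c' : seq T) (I : eqType).
Variables (a b : I -> T) (mid : I -> seq T) (k : nat) (es : nat -> I) (so : seq nat).
Hypotheses (esym : symmetric e) (uc : uniq c) (uc' : uniq c').
Hypotheses (cyc : cycle e c) (cyc' : cycle e c').
Hypothesis cmax : forall D, uniq D -> cycle e D -> size D <= size c.
Hypothesis lk : linkage e c c' a b mid.
Hypothesis k_gt0 : 0 < k.
Hypothesis es_inj : forall i j, i < k.*2 -> j < k.*2 -> es i = es j -> i = j.
Hypothesis dst_seg : forall j, j < k -> seg c' c (b (es j.*2)) = seg c' c (b (es j.*2.+1)).
Hypothesis dst_inj : forall i j, i < k -> j < k ->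
  seg c' c (b (es i.*2)) = seg c' c (b (es j.*2)) -> i = j.
Hypothesis src_seg : forall j, j < k ->
  seg c c' (a (es (prev_end k j))) = seg c c' (a (es j.*2)).
Hypothesis so_perm : perm_eq so (iota 0 k).
Hypothesis so_sorted :
  sorted (fun i j => seg c c' (a (es i.*2)) < seg c c' (a (es j.*2))) so.

Definition exchange_order :=
  block_order k so (fun j => index (a (es (prev_end k j))) c < index (a (es j.*2)) c).

(** Out along one path, along [c'] inside a single segment, and back along the path of the mate. *)
Let conn i := mid (es i) ++ arc_walk c' (b (es i)) (b (es (mate i))) ++ rev (mid (es (mate i))).

Let b_in i : b i \in c'. Proof. by case: (link_dst lk i). Qed.
Let a_in i : a i \in c. Proof. by case: (link_src lk i). Qed.

Lemma conn_path i : path e (a (es i)) (rcons (conn i) (a (es (mate i)))).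
Proof.
rewrite /conn !rcons_cat.
have p1 := link_path lk (es i).
have p2 := path_rev_sym esym (link_path lk (es (mate i))).
move: p1; rewrite rcons_path cat_path => /andP[-> h1] /=.
case Es: (rcons (rev (mid (es (mate i)))) (a (es (mate i)))) p2 => [|y s] /=.
  by move/(congr1 size): Es; rewrite size_rcons.
case/andP=> hy ps.
have sc' : sorted e c' by case: (c') cyc' => //= x s'; rewrite rcons_path => /andP[].
have := arc_walk_path esym sc' (b_in (es i)) (b_in (es (mate i))) h1 hy.
by rewrite rcons_path cat_path => /andP[-> hl] /=; rewrite hl ps.
Qed.

Lemma conn_mate i : conn (mate i) = rev (conn i).
Proof. by rewrite /conn mateK !rev_cat revK -arc_walkC // catA. Qed.

Lemma mem_conn j v : j < k -> v \in conn j.*2 ->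
  (exists2 i, i = j.*2 \/ i = j.*2.+1 & v \in mid (es i)) \/
  [/\ v \in c', v \notin c & seg c' c v = seg c' c (b (es j.*2))].
Proof.
move=> jk; rewrite /conn mate_double !mem_cat mem_rev => /or3P[h|h|h].
- by left; exists j.*2; [left|].
- right; have [||h1 [h2 h3]] := seg_arc uc' (b_in _) (b_in _) _ _ (dst_seg jk) h.
  + by case: (link_dst lk (es j.*2)).
  + by case: (link_dst lk (es j.*2.+1)).
  by split.
- by left; exists j.*2.+1; [right|].
Qed.

Lemma conn_uniq j : j < k -> uniq (conn j.*2).
Proof.
move=> jk; rewrite /conn mate_double !cat_uniq rev_uniq !(link_uniq lk) arc_walk_uniq //= andbT.
have midP i v : v \in mid i -> v \notin c' by case/(link_mid lk).
have inc v : v \in arc_walk c' (b (es j.*2)) (b (es j.*2.+1)) -> v \in c'.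
  by rewrite mem_arc_walk // => /andP[].
apply/andP; split.
  apply/hasPn => v; rewrite mem_cat mem_rev => /orP[/inc h|h]; apply/negP => h'.
    by have := midP _ _ h'; rewrite h.
  by have /es_inj := link_disj lk h' h; lia.
by apply/hasPn => v; rewrite mem_rev => /midP; apply/contra/inc.
Qed.

Lemma conns_uniq : uniq (flatten [seq conn j.*2 | j <- iota 0 k]).
Proof.
apply: uniq_flatten_map; first exact: iota_uniq.
  by move=> j; rewrite mem_iota => /andP[_]; apply: conn_uniq.
move=> i j v; rewrite !mem_iota !add0n /= => ik jk vi vj.
case: (mem_conn ik vi) => [[i' hi' vi']|[vc' vc sv]];
  case: (mem_conn jk vj) => [[j' hj' vj']|[vc2 vc3 sv2]].
- have /es_inj := link_disj lk vi' vj'; lia.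
- by case: (link_mid lk vi') => _; rewrite vc2.
- by case: (link_mid lk vj') => _; rewrite vc'.
- by apply: dst_inj => //; rewrite -sv -sv2.
Qed.

Let prev_lt j : j < k -> prev_end k j < k.*2.
Proof. by case: j => [|j] /=; lia. Qed.

Let prev_neq j : j < k -> prev_end k j != j.*2.
Proof. by move=> jk; apply/eqP; case: j jk => [|j] /=; lia. Qed.

Let first_end j := if index (a (es (prev_end k j))) c < index (a (es j.*2)) c
  then prev_end k j else j.*2.
Let second_end j := if index (a (es (prev_end k j))) c < index (a (es j.*2)) c
  then j.*2 else prev_end k j.

Lemma ends_lt j : j < k -> index (a (es (first_end j))) c < index (a (es (second_end j))) c.
Proof.
move=> jk; rewrite /first_end /second_end; case: ifP => // /negbT; rewrite -leqNgt leq_eqVlt.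
case/orP=> // /eqP/(congr1 (nth (a (es 0)) c)); rewrite !nth_index // => /(link_src_inj lk).
by move/es_inj => h; have := prev_neq jk; rewrite h ?eqxx //; [lia|exact: prev_lt].
Qed.

Lemma ends_seg j : j < k -> seg c c' (a (es (first_end j))) = seg c c' (a (es j.*2)) /\
  seg c c' (a (es (second_end j))) = seg c c' (a (es j.*2)).
Proof. by move=> jk; rewrite /first_end /second_end; case: ifP => _; rewrite src_seg. Qed.

Lemma exchange_order_subseq : subseq [seq a (es i) | i <- exchange_order] c.
Proof.
apply: sorted_index_subseq => //; first by move=> _ /mapP[i _ ->].
rewrite sorted_map /exchange_order /block_order.
have so_lt : {in so, forall j, j < k}.
  by move=> j; rewrite (perm_mem so_perm) mem_iota.
case: so so_lt so_sorted => // j0 s /= h srt.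
rewrite -/(first_end _) -/(second_end _) ends_lt ?h ?inE ?eqxx //=.
elim: s j0 h srt => //= j1 s IH j0 h /andP[h01 srt].
have k0 : j0 < k by rewrite h ?inE ?eqxx.
have k1 : j1 < k by rewrite h ?inE ?eqxx ?orbT.
rewrite -/(first_end _) -/(second_end _) (ends_lt k1) IH // ?andbT.
  apply: (seg_ltW (c' := c')).
  by case: (ends_seg k0) => _ ->; case: (ends_seg k1) => ->.
by move=> z hz; rewrite h // inE hz orbT.
Qed.

(** The rerouted cycle is at most as long as [c]. A connector brings at least [dist + 1] vertices,
    while a dropped arc loses only [dist - 1], because its ends stay; with [k > 0] this makes the
    inequality strict. *)
Lemma half_exchange : single_cycle k exchange_order ->
  \sum_(j <- iota 0 k) dist c' (b (es j.*2)) (b (es j.*2.+1)) <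
  \sum_(j <- iota 0 k) dist c (a (es (prev_end k j))) (a (es j.*2)).
Proof.
move=> single.
have [||D [g [Dc Dcount Dgap]]] :=
  reroute esym k_gt0 uc cyc (block_order_perm _ so_perm) exchange_order_subseq _ _ single
    (cn := conn).
- by move=> i _; apply: conn_path.
- by move=> i _; apply: conn_mate.
have countE P : \sum_(j <- iota 0 k) count P (conn j.*2) =
    count P (flatten [seq conn j.*2 | j <- iota 0 k]).
  by rewrite count_flatten sumnE !big_map.
have Du : uniq D.
  apply: count_mem_uniq => v.
  suff h : count_mem v D <= 1.
    by move: h; rewrite -has_pred1 has_count; case: (count_mem v D) => [|[]].
  apply: leq_trans (_ : count_mem v c + count_mem v (flatten [seq conn j.*2 | j <- iota 0 k]) <= _).
    by rewrite -countE -Dcount leq_addr.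
  rewrite !count_uniq_mem ?conns_uniq //.
  case vc: (v \in c); last by case: (v \in flatten _).
  suff /negPf-> : v \notin flatten [seq conn j.*2 | j <- iota 0 k] by [].
  apply/negP => /flatten_mapP[j]; rewrite mem_iota => /andP[_ jk] /(mem_conn jk)[[i _]|[_]].
    by case/(link_mid lk); rewrite vc.
  by rewrite vc.
have := Dcount predT; rewrite !count_predT.
under [in LHS]eq_bigr do rewrite count_predT.
under [in RHS]eq_bigr do rewrite count_predT.
have := cmax Du Dc.
have conn_size : \sum_(j <- iota 0 k) dist c' (b (es j.*2)) (b (es j.*2.+1)) + k <=
    \sum_(j <- iota 0 k) size (conn j.*2).
  rewrite -{2}(size_iota 0 k) -sum1_size -big_split /=; apply: leq_sum => j _.
  by rewrite /conn !size_cat mate_double size_arc_walk // addn1; clear; lia.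
have gap_size : \sum_(j <- iota 0 k) size (g j) + k =
    \sum_(j <- iota 0 k) dist c (a (es (prev_end k j))) (a (es j.*2)).
  rewrite -{2}(size_iota 0 k) -sum1_size -big_split /=.
  rewrite -[RHS](perm_big _ so_perm) /= [RHS](big_nth 0) /index_iota subn0.
  rewrite (perm_size so_perm) size_iota; apply: eq_big_seq => m; rewrite mem_iota => /andP[_ mk].
  have mso : m < size so by rewrite (perm_size so_perm) size_iota.
  have [e1 e2] := nth_flatten_pairs first_end second_end mso.
  have := Dgap _ mk; rewrite /exchange_order /block_order e1 e2.
  by rewrite /first_end /second_end /dist; case: ifP => _ -> /=; clear; lia.
by move: k_gt0 conn_size gap_size; clear; lia.
Qed.
End HalfExchange.

Lemma prev_endS k j : j < k -> (prev_end k j).+1 %% k.*2 = j.*2.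
Proof.
case: j => [|j] h /=; last by rewrite modn_small; lia.
by rewrite prednK ?modnn //; lia.
Qed.

Lemma prev_end_succ k j : j < k -> prev_end k (j.+1 %% k) = j.*2.+1.
Proof.
move=> jk; case: (ltngtP j.+1 k) => h; first by rewrite modn_small.
  by lia.
by rewrite -h modnn /=.
Qed.

Lemma succ_mod_inj k i j : i < k -> j < k -> i.+1 %% k = j.+1 %% k -> i = j.
Proof.
move=> ik jk; have [ik'|ik'] := eqVneq i.+1 k; have [jk'|jk'] := eqVneq j.+1 k.
- by move=> _; move: jk'; rewrite -ik' => -[].
- have jk1 : j.+1 < k by rewrite ltn_neqAle jk'.
  by rewrite ik' modnn modn_small.
- have ik1 : i.+1 < k by rewrite ltn_neqAle ik'.
  by rewrite jk' modnn modn_small.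
- have ik1 : i.+1 < k by rewrite ltn_neqAle ik'.
  have jk1 : j.+1 < k by rewrite ltn_neqAle jk'.
  by rewrite !modn_small // => -[].
Qed.

Section Exchange.
Variables (T : eqType) (e : rel T) (c1 c2 : seq T) (I : eqType).
Variables (a b : I -> T) (mid : I -> seq T).
Hypotheses (esym : symmetric e) (u1 : uniq c1) (u2 : uniq c2).
Hypotheses (cyc1 : cycle e c1) (cyc2 : cycle e c2).
Hypothesis max1 : forall D, uniq D -> cycle e D -> size D <= size c1.
Hypothesis max2 : forall D, uniq D -> cycle e D -> size D <= size c2.
Hypothesis lk : linkage e c1 c2 a b mid.

Let s1 i := seg c1 c2 (a i).
Let s2 i := seg c2 c1 (b i).
Let p1 i := index (a i) c1.
Let p2 i := index (b i) c2.

(** The only trace of the graph in the combinatorics that follows: [s1], [s2] stand for the segments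
    of the two ends of a path, [p1], [p2] for their positions. *)
Definition exchange_free (I : eqType) (s1 s2 p1 p2 : I -> nat) :=
  forall k (es : nat -> I) so1 so2, 0 < k ->
  (forall i j, i < k.*2 -> j < k.*2 -> es i = es j -> i = j) ->
  (forall j, j < k -> s1 (es (prev_end k j)) = s1 (es j.*2)) ->
  (forall j, j < k -> s2 (es j.*2) = s2 (es j.*2.+1)) ->
  (forall i j, i < k -> j < k -> s1 (es i.*2) = s1 (es j.*2) -> i = j) ->
  (forall i j, i < k -> j < k -> s2 (es i.*2) = s2 (es j.*2) -> i = j) ->
  perm_eq so1 (iota 0 k) -> sorted (fun i j => s1 (es i.*2) < s1 (es j.*2)) so1 ->
  perm_eq so2 (iota 0 k) -> sorted (fun i j => s2 (es i.*2) < s2 (es j.*2)) so2 ->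
  single_cycle k (block_order k so1 (fun j => p1 (es (prev_end k j)) < p1 (es j.*2))) ->
  single_cycle k (block_order k so2 (fun j => p2 (es j.*2) < p2 (es j.*2.+1))) -> False.

Lemma longest_exchange_free : exchange_free s1 s2 p1 p2.
Proof.
move=> k es so1 so2 k0 es_inj e1 e2 i1 i2 pso1 srt1 pso2 srt2 sc1 sc2.
have h1 := half_exchange esym u1 u2 cyc1 cyc2 max1 lk k0 es_inj e2 i2 e1 pso1 srt1 sc1.
(* Seen from the second cycle, the same closed walk is numbered from one end later; this swaps the
   two kinds of pairs of ends. *)
pose es' i := es (i.+1 %% k.*2).
have k2 : 0 < k.*2 by lia.
have esE j : j < k -> es' j.*2 = es j.*2.+1 by move=> jk; rewrite /es' modn_small //; lia.
have esO j : es' j.*2.+1 = es (j.+1 %% k).*2.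
  by rewrite /es' -doubleS -!muln2 muln_modl.
have esP j : j < k -> es' (prev_end k j) = es j.*2 by move=> jk; rewrite /es' prev_endS.
have succ_lt j : j.+1 %% k < k by rewrite ltn_pmod.
have so2_lt j : j \in so2 -> j < k by rewrite (perm_mem pso2) mem_iota.
have h2 : \sum_(j <- iota 0 k) dist c1 (a (es' j.*2)) (a (es' j.*2.+1)) <
    \sum_(j <- iota 0 k) dist c2 (b (es' (prev_end k j))) (b (es' j.*2)).
  apply: (half_exchange esym u2 u1 cyc2 cyc1 max2 (linkage_sym esym lk) k0 (so := so2)) => //.
  - move=> i j ik jk /es_inj; rewrite !ltn_pmod // => /(_ erefl erefl); exact: succ_mod_inj.
  - by move=> j jk; rewrite esE // esO -(prev_end_succ jk) -/(s1 _) e1.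
  - move=> i j ik jk; rewrite !esE // -(prev_end_succ ik) -(prev_end_succ jk) -!/(s1 _) !e1 //.
    by move/i1 => /(_ (succ_lt _) (succ_lt _)); apply: succ_mod_inj.
  - by move=> j jk; rewrite esP // esE // -/(s2 _) e2.
  - rewrite (eq_in_sorted (P := mem so2) (e' := fun i j => s2 (es i.*2) < s2 (es j.*2))) //.
    by move=> i j /so2_lt ik /so2_lt jk; rewrite !esE // -!/(s2 _) !e2.
  - rewrite /exchange_order /block_order; move: sc2; rewrite /block_order.
    set s := flatten _; set s' := flatten _; suff -> : s' = s by [].
    by congr flatten; apply/eq_in_map => j /so2_lt jk; rewrite esP // esE.
(* [h1] and [h2] compare the same two sums in opposite directions. *)
move: h2; rewrite ltnNge => /negP; apply.
rewrite [X in _ <= X](_ : _ = \sum_(j <- iota 0 k) dist c1 (a (es (prev_end k j))) (a (es j.*2))).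
  apply: leq_trans (ltnW h1); rewrite leq_eqVlt; apply/orP; left; apply/eqP.
  by apply: eq_big_seq => j; rewrite mem_iota => /andP[_ jk]; rewrite esP // esE.
have := sum_prev_end k (fun q => dist c1 (a (es q)) (a (es (q.+1 %% k.*2)))).
rewrite [X in X = _](_ : _ = \sum_(j <- iota 0 k) dist c1 (a (es (prev_end k j))) (a (es j.*2))).
  move=> ->; apply: eq_big_seq => j; rewrite mem_iota => /andP[_ jk].
  by rewrite esE.
by apply: eq_big_seq => j; rewrite mem_iota => /andP[_ jk]; rewrite prev_endS.
Qed.
End Exchange.

(** * The finite check *)

(* Index 0 stands for one end of the edge [xy], and 1, 2, 3 for the vertices of a hexagon on the
   same side, where [i] and [j] on opposite sides are adjacent unless [i = j <> 0]. At the hub 0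
   the other indices are ordered by [p], at the leaves 1, 2, 3 in the reverse way; [hub] and
   [leaf] tell whether 0 comes first. *)
Definition hub_order (hub leaf : bool) (p : seq nat) (i j j' : nat) : bool :=
  if j == 0 then (if i == 0 then hub else leaf)
  else if j' == 0 then ~~ (if i == 0 then hub else leaf)
  else let r := index j p < index j' p in if i == 0 then r else ~~ r.

Definition restrict_order (L z : seq nat) := [seq index v z | v <- L & v \in z].

Definition prev_index k j := if j is j'.+1 then j' else k.-1.

(* Found by a computer search: the segments of the first and of the second cycle in the order in
   which an exchange visits them. *)
Definition exchange_cycles : seq (seq nat * seq nat) :=
  [:: ([:: 0; 1; 2], [:: 0; 3; 1]); ([:: 0; 1; 2], [:: 2; 3; 0]);
      ([:: 0; 1; 3], [:: 3; 2; 0]); ([:: 0; 1; 3; 2], [:: 0; 2; 1; 3]);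
      ([:: 0; 1; 3], [:: 0; 2; 1]); ([:: 0; 2; 3], [:: 0; 1; 2]);
      ([:: 0; 2; 3], [:: 3; 1; 0]); ([:: 0; 2; 3], [:: 1; 0; 2]);
      ([:: 0; 1; 3], [:: 2; 0; 1]); ([:: 0; 1; 3], [:: 3; 0; 2]);
      ([:: 0; 1; 2], [:: 2; 0; 3]); ([:: 0; 2; 1; 3], [:: 1; 3; 2; 0]);
      ([:: 0; 1; 3], [:: 3; 0; 1]); ([:: 0; 1; 3; 2], [:: 3; 2; 1; 0]);
      ([:: 0; 2; 1; 3], [:: 0; 3; 2; 1]); ([:: 0; 1; 2], [:: 2; 0; 1]);
      ([:: 0; 2; 3], [:: 3; 0; 2])].

(** These cells are the edges of a cube together with one main diagonal, which is [xy]; the hexagon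
    runs through the six other vertices. *)
Definition cell_present (i j : nat) := (i != j) || (i == 0).

(** Frees the table from trust in the search: every entry is checked to be a closed walk through
    distinct segments and present cells. *)
Definition valid_cycle (z : seq nat * seq nat) :=
  let k := size z.1 in
  [&& 1 < k, size z.2 == k, uniq z.1, uniq z.2, all (gtn 4) z.1, all (gtn 4) z.2 &
    all (fun j => cell_present (nth 0 z.1 j) (nth 0 z.2 j) &&
      cell_present (nth 0 z.1 (j.+1 %% k)) (nth 0 z.2 j)) (iota 0 k)].

Definition connected1 hub leaf p L (z : seq nat * seq nat) :=
  let k := size z.1 in
  single_cycle k (block_order k (restrict_order L z.1)
    (fun j => hub_order hub leaf p (nth 0 z.1 j) (nth 0 z.2 (prev_index k j)) (nth 0 z.2 j))).

(** At [y] the leaves may be taken in increasing order, by renumbering the hexagon; so only the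
    order [p] at [x] has to vary. *)
Definition connected2 hub leaf L (z : seq nat * seq nat) :=
  let k := size z.1 in
  single_cycle k (block_order k (restrict_order L z.2)
    (fun j => hub_order hub leaf [:: 1; 2; 3] (nth 0 z.2 j) (nth 0 z.1 j) (nth 0 z.1 (j.+1 %% k)))).

Definition meet_true (s t : seq bool) := has (fun p => p.1 && p.2) (zip s t).

Definition bools := [:: true; false].
Definition bool_pairs := [seq (x, y) | x <- bools, y <- bools].
Definition perms4 := permutations (iota 0 4).
Definition perms3 := permutations (iota 1 3).

(* The sides are tabulated separately, so that an exchange is evaluated once per side and not once
   per pair of orders. If [hub] equals [leaf] on both sides, the edge [xy] already lies in a
   consistent quadrilateral. *)
Definition all_cases :=
  let t1 := [seq (h.1 == h.2, [seq connected1 h.1 h.2 pL.1 pL.2 z | z <- exchange_cycles])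
    | h <- bool_pairs, pL <- [seq (p, L) | p <- perms3, L <- perms4]] in
  let t2 := [seq (h.1 == h.2, [seq connected2 h.1 h.2 L z | z <- exchange_cycles])
    | h <- bool_pairs, L <- perms4] in
  all (fun s => all (fun t => (s.1 && t.1) || meet_true s.2 t.2) t2) t1.

Lemma all_cases_true : all_cases.
Proof. by vm_compute. Qed.

Lemma exchange_cycles_valid : all valid_cycle exchange_cycles.
Proof. by vm_compute. Qed.

Lemma mem_bool_pairs x y : (x, y) \in bool_pairs.
Proof. by case: x; case: y. Qed.

Lemma exists_exchange_cycle h l h' l' p L L' :
  p \in perms3 -> L \in perms4 -> L' \in perms4 -> ~~ ((h == l) && (h' == l')) ->
  exists2 z, valid_cycle z & connected1 h l p L z && connected2 h' l' L' z.
Proof.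
move=> hp hL hL' neq.
have /allP/(_ (h == l, [seq connected1 h l p L z | z <- exchange_cycles])) := all_cases_true.
case/(_ _)/Wrap.
  apply/allpairsP; exists ((h, l), (p, L)); split; rewrite ?mem_bool_pairs //.
  by apply/allpairsP; exists (p, L).
case=> /allP/(_ (h' == l', [seq connected2 h' l' L' z | z <- exchange_cycles])).
case/(_ _)/Wrap.
  by apply/allpairsP; exists ((h', l'), L'); split; rewrite ?mem_bool_pairs.
cbn [fst snd]; rewrite (negPf neq) /meet_true zip_map has_map => /hasP[z hz hc].
by exists z => //; apply: (allP exchange_cycles_valid).
Qed.

Lemma sort_key_sorted (v : nat -> nat) s : uniq s -> {in s &, injective v} ->
  sorted (fun i j => v i < v j) (sort (fun i j => v i <= v j) s).
Proof.
move=> us vi.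
suff: sorted ltn (map v (sort (fun i j => v i <= v j) s)) by rewrite sorted_map.
rewrite ltn_sorted_uniq_leq sorted_map sort_sorted ?andbT; last first.
  by move=> i j; apply: leq_total.
by rewrite map_inj_in_uniq ?sort_uniq // => i j; rewrite !mem_sort; apply: vi.
Qed.

Lemma index_sort_key (v : nat -> nat) s i j : uniq s -> {in s &, injective v} ->
  i \in s -> j \in s ->
  (index i (sort (fun i j => v i <= v j) s) < index j (sort (fun i j => v i <= v j) s)) = (v i < v j).
Proof.
move=> us vi hi hj; have srt := sort_key_sorted us vi.
set p := sort _ _ in srt *.
have tr : transitive (fun i j => v i < v j) by move=> ? ? ?; apply: ltn_trans.
have mp z : (z \in p) = (z \in s) by rewrite mem_sort.
have lt a b : a \in s -> b \in s -> index a p < index b p -> v a < v b.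
  by move=> ha hb; apply: (sorted_ltn_index tr srt); rewrite mp.
apply/idP/idP; first exact: lt.
move=> vij; rewrite ltnNge leq_eqVlt; apply/negP => /orP[/eqP h|h].
  have ji : j = i by rewrite -(nth_index 0 (s := p) (x := j)) ?mp // h nth_index ?mp.
  by rewrite ji ltnn in vij.
by have := ltn_trans vij (lt _ _ hj hi h); rewrite ltnn.
Qed.

(** * The graph of segments *)

Lemma eq_block_order k so bt bt' : {in so, bt =1 bt'} ->
  block_order k so bt = block_order k so bt'.
Proof. by move=> h; congr flatten; apply/eq_in_map => j /h ->. Qed.

Lemma prev_index_lt k j : j < k -> prev_index k j < k.
Proof. by case: j => [|j] /=; lia. Qed.

Lemma succ_prev_index k j : j < k -> (prev_index k j).+1 %% k = j.
Proof. by case: j => [|j] jk /=; rewrite ?prednK ?modnn // modn_small. Qed.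

Lemma restrict_order_perm L z : L \in perms4 -> uniq z -> all (gtn 4) z ->
  perm_eq (restrict_order L z) (iota 0 (size z)).
Proof.
rewrite mem_permutations => pL uz /allP z4.
have -> : iota 0 (size z) = [seq index v z | v <- z].
  apply: (@eq_from_nth _ 0); rewrite ?size_iota ?size_map // => i hi.
  by rewrite nth_iota // (nth_map 0) // index_uniq.
apply/perm_map/uniq_perm => //; first by rewrite filter_uniq // (perm_uniq pL) iota_uniq.
move=> v; rewrite mem_filter; case vz: (v \in z) => //=.
by rewrite (perm_mem pL) mem_iota; apply: z4.
Qed.

Lemma restrict_order_sorted (v : nat -> nat) L z : uniq z ->
  sorted (fun i j => v i < v j) L ->
  sorted (fun i j => v (nth 0 z i) < v (nth 0 z j)) (restrict_order L z).
Proof.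
move=> uz srt; rewrite /restrict_order sorted_map.
rewrite (eq_in_sorted (P := mem z) (e' := fun i j => v i < v j)).
- by apply: sorted_filter => // ? ? ?; apply: ltn_trans.
- by move=> i j hi hj /=; rewrite !nth_index.
- by apply/allP => i; rewrite mem_filter => /andP[].
Qed.

Section Grid.
Variables (I : finType) (s1 s2 p1 p2 : I -> nat).
Hypothesis ex : exchange_free s1 s2 p1 p2.
Hypotheses (p1_inj : injective p1) (p2_inj : injective p2).

(** The case [k = 1]: replacing one arc always leaves a single cycle, in whichever order its two
    ends occur. *)
Lemma segments_determine i j : s1 i = s1 j -> s2 i = s2 j -> i = j.
Proof.
move=> e1 e2; apply/eqP/negP => /negP ij.
pose es q := if q == 0 then i else j.
apply: (ex (k := 1) (es := es) (so1 := [:: 0]) (so2 := [:: 0])) => //.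
- by case=> [|[|]] // [|[|]] //= _ _; rewrite /es /= => h; move: ij; rewrite h eqxx.
- by case.
- by case.
- by case=> [|] // [|].
- by case=> [|] // [|].
- by rewrite /block_order /=; case: (_ < _).
- by rewrite /block_order /=; case: (_ < _).
Qed.

Variable i0 : I.
(* The value is [i0] if no path joins the two segments. *)
Definition cell x y : I := odflt i0 [pick i | (s1 i == x) && (s2 i == y)].
Definition occupied x y := [exists i, (s1 i == x) && (s2 i == y)].
Definition P1 x y := p1 (cell x y).
Definition P2 x y := p2 (cell x y).

Lemma cellP x y : occupied x y -> s1 (cell x y) = x /\ s2 (cell x y) = y.
Proof.
rewrite /cell; case: pickP => [i /andP[/eqP ? /eqP ?] //|h] /existsP[i]; by rewrite h.
Qed.

Lemma P1_total x y y' : occupied x y -> occupied x y' -> y != y' ->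
  (P1 x y' < P1 x y) = ~~ (P1 x y < P1 x y').
Proof.
move=> /cellP[_ h] /cellP[_ h'] yy; rewrite -leqNgt ltn_neqAle; apply/andb_idl => _.
by apply/eqP => /p1_inj/(congr1 s2) hh; move: yy; rewrite -h -h' hh eqxx.
Qed.

Lemma P2_total x x' y : occupied x y -> occupied x' y -> x != x' ->
  (P2 x' y < P2 x y) = ~~ (P2 x y < P2 x' y).
Proof.
move=> /cellP[h _] /cellP[h' _] yy; rewrite -leqNgt ltn_neqAle; apply/andb_idl => _.
by apply/eqP => /p2_inj/(congr1 s1) hh; move: yy; rewrite -h -h' hh eqxx.
Qed.

(** An exchange along the closed walk [xs 0], [ys 0], [xs 1], and so on: end [2j] is the path
    between [xs j] and [ys j], end [2j + 1] the path between [xs (j + 1)] and [ys j]. *)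
Lemma grid_exchange k (xs ys : nat -> nat) so1 so2 : 1 < k ->
  (forall j, j < k -> occupied (xs j) (ys j)) ->
  (forall j, j < k -> occupied (xs (j.+1 %% k)) (ys j)) ->
  (forall i j, i < k -> j < k -> xs i = xs j -> i = j) ->
  (forall i j, i < k -> j < k -> ys i = ys j -> i = j) ->
  perm_eq so1 (iota 0 k) -> sorted (fun i j => xs i < xs j) so1 ->
  perm_eq so2 (iota 0 k) -> sorted (fun i j => ys i < ys j) so2 ->
  single_cycle k (block_order k so1
    (fun j => P1 (xs j) (ys (prev_index k j)) < P1 (xs j) (ys j))) ->
  single_cycle k (block_order k so2
    (fun j => P2 (xs j) (ys j) < P2 (xs (j.+1 %% k)) (ys j))) -> False.
Proof.
move=> k1 o1 o2 xi yi pso1 srt1 pso2 srt2 sc1 sc2.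
have k0 : 0 < k by apply: ltnW.
pose es q := if odd q then cell (xs (q./2.+1 %% k)) (ys q./2) else cell (xs q./2) (ys q./2).
have esE j : es j.*2 = cell (xs j) (ys j) by rewrite /es odd_double doubleK.
have esO j : es j.*2.+1 = cell (xs (j.+1 %% k)) (ys j).
  by rewrite /es /= odd_double /= uphalf_double.
have esP j : j < k -> es (prev_end k j) = cell (xs j) (ys (prev_index k j)).
  move=> jk; have -> : prev_end k j = (prev_index k j).*2.+1.
    by case: j jk => [|j] //= _; rewrite -[in LHS](prednK k0) doubleS.
  by rewrite esO succ_prev_index.
have mem1 j : j \in so1 -> j < k by rewrite (perm_mem pso1) mem_iota.
have mem2 j : j \in so2 -> j < k by rewrite (perm_mem pso2) mem_iota.
have c1 j : j < k -> s1 (es j.*2) = xs j by move=> jk; rewrite esE; case: (cellP (o1 _ jk)).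
have c2 j : j < k -> s2 (es j.*2) = ys j by move=> jk; rewrite esE; case: (cellP (o1 _ jk)).
have c1' j : j < k -> s1 (es j.*2.+1) = xs (j.+1 %% k).
  by move=> jk; rewrite esO; case: (cellP (o2 _ jk)).
have c2' j : j < k -> s2 (es j.*2.+1) = ys j.
  by move=> jk; rewrite esO; case: (cellP (o2 _ jk)).
have srt s (P : nat -> I) v (w : I -> nat) : (forall j, j \in s -> w (P j) = v j) ->
    sorted (fun i j => v i < v j) s -> sorted (fun i j => w (P i) < w (P j)) s.
  move=> h; rewrite (eq_in_sorted (P := mem s) (e' := fun i j => w (P i) < w (P j))) //.
  by move=> i j hi hj; rewrite !h.
apply: (ex (k := k) (es := es) k0 (so1 := so1) (so2 := so2)) => //.
(* Ends of different parity could coincide only if [xs] took equal values at [j] and at [j + 1]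
   modulo [k], which [k > 1] excludes. *)
- move=> q q' qk q'k.
  have hq : q./2 < k by lia.
  have hq' : q'./2 < k by lia.
  rewrite -(odd_double_half q) -(odd_double_half q').
  case: (odd q); case: (odd q'); rewrite ?add0n ?add1n => h.
  + by congr _.*2.+1; apply: yi => //; rewrite -!c2' // h.
  + have e1 : q./2 = q'./2 by apply: yi => //; rewrite -(c2' _ hq) -(c2 _ hq') h.
    have := congr1 s1 h; rewrite c1' // c1 // e1 => /xi; rewrite ltn_pmod // => /(_ erefl hq').
    have [E|E] := eqVneq q'./2.+1 k; first by rewrite E modnn => h0; move: E k1; rewrite -h0; clear; lia.
    have hs : q'./2.+1 < k by rewrite ltn_neqAle E.
    by rewrite (modn_small hs) => /eqP; rewrite eqn_leq ltnn.
  + have e1 : q./2 = q'./2 by apply: yi => //; rewrite -(c2 _ hq) -(c2' _ hq') h.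
    have := congr1 s1 h; rewrite (c1 _ hq) (c1' _ hq') e1 => /esym/xi; rewrite ltn_pmod // => /(_ erefl hq').
    have [E|E] := eqVneq q'./2.+1 k; first by rewrite E modnn => h0; move: E k1; rewrite -h0; clear; lia.
    have hs : q'./2.+1 < k by rewrite ltn_neqAle E.
    by rewrite (modn_small hs) => /eqP; rewrite eqn_leq ltnn.
  + by congr _.*2; apply: xi => //; rewrite -!c1 // h.
- move=> j jk; rewrite c1 // esP //.
  have [|-> _ //] := @cellP (xs j) (ys (prev_index k j)).
  by rewrite -{1}(succ_prev_index jk); apply/o2/prev_index_lt.
- by move=> j jk; rewrite c2 // c2'.
- by move=> i j ik jk; rewrite !c1 //; apply: xi.
- by move=> i j ik jk; rewrite !c2 //; apply: yi.
- by apply: srt srt1 => j /mem1/c1.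
- by apply: srt srt2 => j /mem2/c2.
- rewrite (@eq_block_order k so1 _ (fun j => P1 (xs j) (ys (prev_index k j)) < P1 (xs j) (ys j))) //.
  by move=> j /mem1 jk; rewrite esP // esE.
- rewrite (@eq_block_order k so2 _ (fun j => P2 (xs j) (ys j) < P2 (xs (j.+1 %% k)) (ys j))) //.
  by move=> j /mem2 jk; rewrite esO // esE.
Qed.

(** The walk passes [x] and [x'] in opposite senses, and [y] and [y'] too. Equal orders therefore
    become opposite bits in [block_order], and with opposite bits two arcs are replaced without
    splitting the cycle. *)
Lemma no_consistent_quad x x' y y' : x != x' -> y != y' ->
  occupied x y -> occupied x y' -> occupied x' y -> occupied x' y' ->
  (P1 x y < P1 x y') = (P1 x' y < P1 x' y') ->
  (P2 x y < P2 x' y) = (P2 x y' < P2 x' y') -> False.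
Proof.
move=> xx yy o1 o2 o3 o4 h1 h2.
pose xs j := if j is 0 then x else x'; pose ys j := if j is 0 then y else y'.
have ord (u v : nat) : u != v -> exists2 so, (so = [:: 0; 1] \/ so = [:: 1; 0]) &
    sorted (fun i j => (if i is 0 then u else v) < (if j is 0 then u else v)) so.
  rewrite neq_ltn => /orP[h|h]; first by exists [:: 0; 1]; [left|rewrite /= h].
  by exists [:: 1; 0]; [right|rewrite /= h].
have [so1 so1E srt1] := ord _ _ xx; have [so2 so2E srt2] := ord _ _ yy.
have conn so bt : so = [:: 0; 1] \/ so = [:: 1; 0] -> bt 0 = ~~ bt 1 ->
    single_cycle 2 (block_order 2 so bt).
  by move=> [] -> h; rewrite /block_order /= h; case: (bt 1).
apply: (@grid_exchange 2 xs ys so1 so2) => //.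
- by case=> [|[|]].
- by case=> [|[|]].
- by case=> [|[|]] // [|[|]] //= _ _ h; rewrite h eqxx in xx.
- by case=> [|[|]] // [|[|]] //= _ _ h; rewrite h eqxx in yy.
- by case: so1E => ->.
- by case: so2E => ->.
- by apply: conn => //=; rewrite P1_total // h1.
- by apply: conn => //=; rewrite h2 [in RHS]P2_total // negbK.
Qed.

(** The actual orders of the four segments on each cycle, obtained by sorting, are among the
    tabulated ones, so some exchange of the table succeeds on both cycles at once. *)
Lemma no_hub_hexagon (xv yv : nat -> nat) h l h' l' p :
  (forall i j, i < 4 -> j < 4 -> xv i = xv j -> i = j) ->
  (forall i j, i < 4 -> j < 4 -> yv i = yv j -> i = j) ->
  (forall i j, i < 4 -> j < 4 -> cell_present i j -> occupied (xv i) (yv j)) ->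
  p \in perms3 -> ~~ ((h == l) && (h' == l')) ->
  (forall i j j', i < 4 -> j < 4 -> j' < 4 -> cell_present i j -> cell_present i j' ->
    j != j' -> (P1 (xv i) (yv j) < P1 (xv i) (yv j')) = hub_order h l p i j j') ->
  (forall j i i', j < 4 -> i < 4 -> i' < 4 -> cell_present i j -> cell_present i' j ->
    i != i' -> (P2 (xv i) (yv j) < P2 (xv i') (yv j)) = hub_order h' l' [:: 1; 2; 3] j i i') ->
  False.
Proof.
move=> xi yi occ hp neq a1 a2.
have inj4 (v : nat -> nat) : (forall i j, i < 4 -> j < 4 -> v i = v j -> i = j) ->
    {in iota 0 4 &, injective v}.
  by move=> vi i j; rewrite !mem_iota; apply: vi.
have u4 := iota_uniq 0 4.
pose L1 := sort (fun i j => xv i <= xv j) (iota 0 4).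
pose L2 := sort (fun i j => yv i <= yv j) (iota 0 4).
have srt1 : sorted (fun i j => xv i < xv j) L1 by apply/sort_key_sorted/inj4.
have srt2 : sorted (fun i j => yv i < yv j) L2 by apply/sort_key_sorted/inj4.
have hL1 : L1 \in perms4 by rewrite mem_permutations perm_sort.
have hL2 : L2 \in perms4 by rewrite mem_permutations perm_sort.
have [[zi zj] /= vz /andP[con1 con2]] := exists_exchange_cycle hp hL1 hL2 neq.
case/and5P: vz => /= k1 /eqP szj ui uj /and3P[li lj /allP pres].
have ltz z : all (gtn 4) z -> forall q, q < size z -> nth 0 z q < 4.
  by move=> /allP z4 q hq; apply/z4/mem_nth.
have k0 : 0 < size zi by apply: ltnW.
have lti := ltz zi li.
have presP j : j < size zi -> cell_present (nth 0 zi j) (nth 0 zj j) /\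
    cell_present (nth 0 zi (j.+1 %% size zi)) (nth 0 zj j).
  by move=> jk; apply/andP/pres; rewrite mem_iota.
have ltj q : q < size zi -> nth 0 zj q < 4 by rewrite -szj; apply: ltz.
have succ_lt j : j.+1 %% size zi < size zi by rewrite ltn_pmod.
have pso1 := restrict_order_perm hL1 ui li.
have pso2 := restrict_order_perm hL2 uj lj; rewrite szj in pso2.
apply: (@grid_exchange (size zi) (fun j => xv (nth 0 zi j)) (fun j => yv (nth 0 zj j))
  (restrict_order L1 zi) (restrict_order L2 zj)) => //.
- by move=> j jk; have jk' := succ_lt j; apply: occ; rewrite ?lti ?ltj //; case: (presP j jk).
- by move=> j jk; have jk' := succ_lt j; apply: occ; rewrite ?lti ?ltj //; case: (presP j jk).
- move=> i j ik jk /xi; rewrite !lti // => /(_ erefl erefl) /eqP.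
  by rewrite nth_uniq // => /eqP.
- move=> i j ik jk /yi; rewrite !ltj // => /(_ erefl erefl) /eqP.
  by rewrite nth_uniq ?szj // => /eqP.
- exact: restrict_order_sorted.
- exact: restrict_order_sorted.
- move: con1; rewrite /connected1 /=; set s := block_order _ _ _; set s' := block_order _ _ _.
  suff -> : s = s' by [].
  apply: eq_block_order => j; rewrite (perm_mem pso1) mem_iota => /andP[_ jk].
  have jk' := prev_index_lt jk.
  rewrite a1 ?lti ?ltj //.
  + by case: (presP _ (prev_index_lt jk)) => _; rewrite succ_prev_index.
  + by case: (presP j jk).
  + by rewrite nth_uniq ?szj ?prev_index_lt //; case: (j) jk k1 => [|j'] /=; clear; lia.
- move: con2; rewrite /connected2 /=; set s := block_order _ _ _; set s' := block_order _ _ _.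
  suff -> : s = s' by [].
  apply: eq_block_order => j; rewrite (perm_mem pso2) mem_iota => /andP[_ jk].
  have jk' := succ_lt j.
  rewrite a2 ?lti ?ltj //.
  + by case: (presP j jk).
  + by case: (presP j jk).
  + rewrite nth_uniq //; have [E|E] := eqVneq j.+1 (size zi).
      by rewrite E modnn; move: E k1; clear; lia.
    have hs : j.+1 < size zi by rewrite ltn_neqAle E.
    by rewrite (modn_small hs) neq_ltn ltnSn.
Qed.

Definition quad_type x y b a :=
  ((P1 x y < P1 x a, P1 b y < P1 b a), (P2 x y < P2 b y, P2 x a < P2 b a)).

Definition link x y t b a :=
  [&& occupied b a, occupied x a, occupied b y, a != y, b != x & quad_type x y b a == t].

Lemma linkP x y t b a : link x y t b a ->
  [/\ occupied b a, occupied x a, occupied b y, a != y & b != x] /\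
  [/\ (P1 x y < P1 x a) = t.1.1, (P1 b y < P1 b a) = t.1.2,
      (P2 x y < P2 b y) = t.2.1 & (P2 x a < P2 b a) = t.2.2].
Proof. by case/and5P=> ? ? ? ? /andP[? /eqP <-]. Qed.

Section Links.
Variables (x y : nat) (t : (bool * bool) * (bool * bool)).
Hypothesis oxy : occupied x y.

Lemma link_type b a : link x y t b a -> ~~ ((t.1.1 == t.1.2) && (t.2.1 == t.2.2)).
Proof.
case/linkP=> [[o1 o2 o3 ay bx] [e1 e2 e3 e4]]; apply/negP => /andP[/eqP h1 /eqP h2].
apply: (@no_consistent_quad x b y a); rewrite // 1?eq_sym ?e1 ?e2 ?e3 ?e4 //.
Qed.

(* The quadruple [x, b; a, a'] is consistent on the second cycle, hence inconsistent on the first. *)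
Lemma link_order1 b a a' : a != a' -> link x y t b a -> link x y t b a' ->
  (P1 b a < P1 b a') = ~~ (P1 x a < P1 x a').
Proof.
move=> aa /linkP[[o1 o2 o3 ay bx] [e1 e2 e3 e4]] /linkP[[o1' o2' _ ay' _] [_ _ _ e4']].
case h: (P1 b a < P1 b a'); case h': (P1 x a < P1 x a') => //; exfalso;
  by apply: (@no_consistent_quad x b a a'); rewrite // 1?eq_sym // ?e4 ?e4' ?h ?h'.
Qed.

Lemma link_order2 b b' a : b != b' -> link x y t b a -> link x y t b' a ->
  (P2 b a < P2 b' a) = ~~ (P2 b y < P2 b' y).
Proof.
move=> bb /linkP[[o1 o2 o3 ay bx] [e1 e2 e3 e4]] /linkP[[o1' _ o3' _ bx'] [_ e2' _ _]].
case h: (P2 b a < P2 b' a); case h': (P2 b y < P2 b' y) => //; exfalso;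
  by apply: (@no_consistent_quad b b' y a); rewrite // 1?eq_sym // ?e2 ?e2' ?h ?h'.
Qed.

(** At [b] and at [b'] the order of [a] and [a'] is the reverse of that at [x], so the two agree;
    likewise for [b] and [b'] on the second cycle, compared with [y]. The 4-cycle would be a
    consistent quadrilateral. *)
Lemma link_no_C4 b b' a a' : b != b' -> a != a' ->
  link x y t b a -> link x y t b a' -> link x y t b' a -> link x y t b' a' -> False.
Proof.
move=> bb aa h1 h2 h3 h4.
have [[o1 _ _ _ _] _] := linkP h1; have [[o2 _ _ _ _] _] := linkP h2.
have [[o3 _ _ _ _] _] := linkP h3; have [[o4 _ _ _ _] _] := linkP h4.
apply: (@no_consistent_quad b b' a a') => //.
  by rewrite (link_order1 aa h1 h2) (link_order1 aa h3 h4).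
by rewrite (link_order2 bb h1 h3) (link_order2 bb h2 h4).
Qed.

(** Opposite vertices of the hexagon share a number, and the hubs [x] and [y] get 0. The class [t]
    places the hub among the leaves, and [link_order1] and [link_order2] reverse the orders at the
    leaves: this is the pattern of [hub_order]. *)
Lemma link_no_C6_sorted b1 b2 b3 a1 a2 a3 :
  P2 b1 y < P2 b2 y -> P2 b2 y < P2 b3 y -> a1 != a2 -> a1 != a3 -> a2 != a3 ->
  link x y t b1 a2 -> link x y t b1 a3 -> link x y t b2 a1 -> link x y t b2 a3 ->
  link x y t b3 a1 -> link x y t b3 a2 -> False.
Proof.
move=> lt12 lt23 n12 n13 n23 l12 l13 l21 l23 l31 l32.
pose xv i := nth 0 [:: x; b1; b2; b3] i.
pose yv j := nth 0 [:: y; a1; a2; a3] j.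
have lt13 := ltn_trans lt12 lt23.
have neqb b b' : P2 b y < P2 b' y -> b != b' by apply: contraTneq => ->; rewrite ltnn.
have m12 := neqb _ _ lt12; have m13 := neqb _ _ lt13; have m23 := neqb _ _ lt23.
have [[o12 ox2 o1y n2 m1] [t12 t12' t12'' t12''']] := linkP l12.
have [[o13 ox3 _ n3 _] [t13 t13' t13'' t13''']] := linkP l13.
have [[o21 ox1 o2y n1 m2] [t21 t21' t21'' t21''']] := linkP l21.
have [[o23 _ _ _ _] [t23 t23' t23'' t23''']] := linkP l23.
have [[o31 _ o3y _ m3] [t31 t31' t31'' t31''']] := linkP l31.
have [[o32 _ _ _ _] [t32 t32' t32'' t32''']] := linkP l32.
pose v j := P1 x (yv j).
pose p := sort (fun i j => v i <= v j) (iota 1 3).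
have yi i j : i < 4 -> j < 4 -> yv i = yv j -> i = j.
  have uy : uniq [:: y; a1; a2; a3].
    by rewrite /= !inE !negb_or n12 n13 n23 !(eq_sym y) n1 n2 n3.
  by move=> hi hj /eqP; rewrite nth_uniq // => /eqP.
have xi i j : i < 4 -> j < 4 -> xv i = xv j -> i = j.
  have ux : uniq [:: x; b1; b2; b3].
    by rewrite /= !inE !negb_or m12 m13 m23 !(eq_sym x) m1 m2 m3.
  by move=> hi hj /eqP; rewrite nth_uniq // => /eqP.
have ox j : j < 4 -> occupied x (yv j) by case: j => [|[|[|[|]]]].
have vi : {in iota 1 3 &, injective v}.
  move=> i j; rewrite !mem_iota => /andP[_ hi] /andP[_ hj].
  move/p1_inj/(congr1 s2).
  by have [_ ->] := cellP (ox _ hi); have [_ ->] := cellP (ox _ hj) => /yi->.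
have ip i j : i \in iota 1 3 -> j \in iota 1 3 -> (index i p < index j p) = (v i < v j).
  by move=> hi hj; apply: index_sort_key => //; apply: iota_uniq.
have lk i j : 0 < i < 4 -> 0 < j < 4 -> i != j -> link x y t (xv i) (yv j).
  by case: i => [|[|[|[|]]]] //; case: j => [|[|[|[|]]]].
have [hx hy] : (forall j, 0 < j < 4 -> (P1 x y < P1 x (yv j)) = t.1.1) /\
    (forall i, 0 < i < 4 -> (P2 x y < P2 (xv i) y) = t.2.1).
  by split; case=> [|[|[|[|]]]].
have oy i : i < 4 -> occupied (xv i) y by case: i => [|[|[|[|]]]].
have occ i j : i < 4 -> j < 4 -> cell_present i j -> occupied (xv i) (yv j).
  case: i => [|i] hi; first by move=> hj _; apply: ox.
  case: j => [|j] hj; first by move=> _; apply: oy.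
  by rewrite /cell_present orbF => ij; case: (linkP (lk i.+1 j.+1 hi hj ij)) => [[]].
have neqy i j : i < 4 -> j < 4 -> i != j -> yv i != yv j.
  by move=> hi hj; apply: contra => /eqP/yi->.
have neqx i j : i < 4 -> j < 4 -> i != j -> xv i != xv j.
  by move=> hi hj; apply: contra => /eqP/xi->.
apply: (@no_hub_hexagon xv yv t.1.1 t.1.2 t.2.1 t.2.2 p) => //.
- by rewrite mem_permutations perm_sort.
- exact: link_type l12.
- have first i j : i < 4 -> 0 < j < 4 -> cell_present i j ->
      (P1 (xv i) y < P1 (xv i) (yv j)) = if i == 0 then t.1.1 else t.1.2.
    case: i => [|i] hi hj; first by move=> _; apply: hx.
    rewrite /cell_present orbF => ij.
    by case: (linkP (lk i.+1 j hi hj ij)) => _ [].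
  move=> i j j' hi hj hj' pj pj' jj; rewrite /hub_order.
  case: j j' hj hj' pj pj' jj => [|j] [|j'] hj hj' pj pj' jj //.
  + exact: first.
  + rewrite -(first i j.+1) // P1_total ?negbK //; last exact: neqy.
    + exact: oy.
    + exact: (occ i j.+1).
  rewrite ip ?mem_iota // -[j.+1 == 0]/false -[j'.+1 == 0]/false /=.
  case: i hi pj pj' => [|i] hi //; rewrite /cell_present !orbF => pj pj'.
  exact: (link_order1 (neqy j.+1 j'.+1 hj hj' jj) (lk i.+1 j.+1 hi hj pj) (lk i.+1 j'.+1 hi hj' pj')).
- have first j i : j < 4 -> 0 < i < 4 -> cell_present i j ->
      (P2 x (yv j) < P2 (xv i) (yv j)) = if j == 0 then t.2.1 else t.2.2.
    case: j => [|j] hj hi; first by move=> _; apply: hy.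
    rewrite /cell_present => ij.
    have {}ij : i != j.+1 by case: (i) hi ij => // i' _; rewrite orbF.
    by case: (linkP (lk i j.+1 hi hj ij)) => _ [].
  move=> j i i' hj hi hi' pi pi' ii; rewrite /hub_order.
  case: i i' hi hi' pi pi' ii => [|i] [|i'] hi hi' pi pi' ii //.
  + exact: first.
  + rewrite -(first j i.+1) // P2_total ?negbK //; last exact: neqx.
    + exact: (ox j).
    + exact: (occ i.+1 j).
  have -> : (index i.+1 [:: 1; 2; 3] < index i'.+1 [:: 1; 2; 3]) = (P2 (xv i.+1) y < P2 (xv i'.+1) y).
    case: i i' hi hi' ii { pi pi'} => [|[|[|]]] // [|[|[|]]] //= _ _ _; rewrite ?lt12 ?lt23 ?lt13 //;
      by rewrite [RHS]ltnNge [X in ~~ X]ltnW.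
  rewrite -[i.+1 == 0]/false -[i'.+1 == 0]/false /=.
  case: j hj pi pi' => [|j] hj //; rewrite /cell_present !orbF => pi pi'.
  exact: (link_order2 (neqx i.+1 i'.+1 hi hi' ii) (lk i.+1 j.+1 hi hj pi) (lk i'.+1 j.+1 hi' hj pi')).
Qed.

(** The [b]'s are renumbered by their order at [y], and the [a]'s along with them. Two of the eight
    outcomes of the comparisons are cyclic, hence impossible. *)
Lemma link_no_C6 b1 b2 b3 a1 a2 a3 :
  b1 != b2 -> b1 != b3 -> b2 != b3 -> a1 != a2 -> a1 != a3 -> a2 != a3 ->
  link x y t b1 a2 -> link x y t b1 a3 -> link x y t b2 a1 -> link x y t b2 a3 ->
  link x y t b3 a1 -> link x y t b3 a2 -> False.
Proof.
move=> m12 m13 m23 n12 n13 n23 l12 l13 l21 l23 l31 l32.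
have o b a : link x y t b a -> occupied b y by case/linkP=> [[]].
have tot b b' : occupied b y -> occupied b' y -> b != b' -> (P2 b y < P2 b' y) \/ (P2 b' y < P2 b y).
  by move=> ob ob' bb; rewrite (P2_total ob ob' bb); case: (_ < _); [left|right].
have [n21 n31 n32] : [/\ a2 != a1, a3 != a1 & a3 != a2] by rewrite ![_ == a1]eq_sym (eq_sym a3).
case: (tot _ _ (o _ _ l12) (o _ _ l21) m12) => h12;
case: (tot _ _ (o _ _ l12) (o _ _ l31) m13) => h13;
case: (tot _ _ (o _ _ l21) (o _ _ l31) m23) => h23.
- exact: (link_no_C6_sorted h12 h23 n12 n13 n23).
- exact: (link_no_C6_sorted h13 h23 n13 n12 n32).
- by have := ltn_trans (ltn_trans h12 h23) h13; rewrite ltnn.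
- exact: (link_no_C6_sorted h13 h12 n31 n32 n12).
- exact: (link_no_C6_sorted h12 h13 n21 n23 n13).
- by have := ltn_trans (ltn_trans h12 h13) h23; rewrite ltnn.
- exact: (link_no_C6_sorted h23 h13 n23 n21 n31).
- exact: (link_no_C6_sorted h23 h12 n32 n31 n21).
Qed.
End Links.
End Grid.

(** * Menger's theorem *)

Section Menger.
Variable T : finType.
Implicit Types (e : rel T) (A B S : {set T}) (p : T * seq T).

Definition vertices p := p.1 :: p.2.

Definition linking e A B p :=
  [&& p.1 \in A, path e p.1 p.2, last p.1 p.2 \in B & uniq (vertices p)].

Definition separates e A B S := forall x s, x \in A -> path e x s -> last x s \in B ->
  has (mem S) (x :: s).

Definition disjoint_paths k (P : 'I_k -> T * seq T) :=
  forall i j v, v \in vertices (P i) -> v \in vertices (P j) -> i = j.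

Lemma shorten_paths e A B k (P : 'I_k -> T * seq T) :
  (forall i, [&& (P i).1 \in A, path e (P i).1 (P i).2 & last (P i).1 (P i).2 \in B]) ->
  disjoint_paths P -> exists2 P' : 'I_k -> T * seq T,
    forall i, linking e A B (P' i) & disjoint_paths P'.
Proof.
move=> hP disj.
exists (fun i => ((P i).1, shorten (P i).1 (P i).2)) => [i|i j v].
  rewrite /linking /vertices /=; have /and3P[-> hp hl] := hP i.
  by case: (shortenP hp) hl => s' -> us _ ->.
have sub l : {subset (P l).1 :: shorten (P l).1 (P l).2 <= vertices (P l)}.
  have /and3P[_ hp _] := hP l; case: (shortenP hp) => s' _ _ hs z.
  by rewrite /vertices !inE => /orP[->//|/hs->]; rewrite orbT.
by move=> /sub vi /sub vj; apply: disj vi vj.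
Qed.

Definition remove_arc e x y : rel T := fun u v => e u v && ((u, v) != (x, y)).

Lemma remove_arc_path e x y u s : path (remove_arc e x y) u s -> path e u s.
Proof. by apply: sub_path => a b /andP[]. Qed.

Lemma path_remove_src e x y u s : x \notin belast u s -> path e u s ->
  path (remove_arc e x y) u s.
Proof.
elim: s u => //= v s IH u; rewrite inE negb_or => /andP[xu xs] /andP[uv /IH->] //.
by rewrite /remove_arc uv xpair_eqE eq_sym (negPf xu).
Qed.

Lemma path_remove_dst e x y u s : y \notin s -> path e u s -> path (remove_arc e x y) u s.
Proof.
elim: s u => //= v s IH u; rewrite inE negb_or => /andP[yv ys] /andP[uv /IH->] //.
by rewrite /remove_arc uv xpair_eqE [v == y]eq_sym (negPf yv) andbF.
Qed.

Lemma separates_src e A B S x y : separates (remove_arc e x y) A B S ->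
  separates e A B (x |: S).
Proof.
move=> sep u s uA pe lB; case xs: (x \in belast u s).
  by apply/hasP; exists x; [apply: mem_belast|rewrite !inE eqxx].
have /hasP[v vs vS] := sep u s uA (path_remove_src y (negbT xs) pe) lB.
by apply/hasP; exists v => //; apply: setU1r.
Qed.

Lemma separates_dst e A B S x y : separates (remove_arc e x y) A B S ->
  separates e A B (y |: S).
Proof.
move=> sep u s uA pe lB; case ys: (y \in s).
  by apply/hasP; exists y; rewrite ?inE ?ys ?orbT ?eqxx.
have /hasP[v vs vS] := sep u s uA (path_remove_dst x (negbT ys) pe) lB.
by apply/hasP; exists v => //; apply: setU1r.
Qed.

(** A walk from [A] stopped at its first vertex of [x |: S] never leaves [x], so it survives the
    removal of the arc from [x] to [y]. *)
Lemma separates_trans_src e A B S x y W :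
  separates e A B (x |: S) -> separates (remove_arc e x y) A (x |: S) W -> separates e A B W.
Proof.
move=> sep sepW u s uA pe lB.
have hs := sep u s uA pe lB.
case: (u \in x |: S) / boolP => uS.
  by have := sepW u [::] uA erefl uS; rewrite /= orbF => ->.
have {}hs : has (mem (x |: S)) s by move: hs; rewrite /= (negPf uS).
case/split_find: hs pe {lB} => z s1 s2 zS noS; rewrite cat_path => /andP[pe _].
have : x \notin belast u (rcons s1 z).
  rewrite belast_rcons inE negb_or; apply/andP; split.
    by apply: contra uS => /eqP <-; apply: setU11.
  by apply: contra noS => xs; apply/hasP; exists x => //; apply: setU11.
move=> /(path_remove_src y)/(_ pe) pe'.
have := sepW u _ uA pe'; rewrite last_rcons => /(_ zS) /hasP[v vs vW].
by apply/hasP; exists v => //; move: vs; rewrite !inE mem_cat => /orP[->|->]; rewrite ?orbT.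
Qed.

Lemma last_hit (D : pred T) u s : has D (u :: s) ->
  exists z s1 s2, [/\ u :: s = s1 ++ z :: s2, D z & ~~ has D s2].
Proof.
elim: s u => [|v s IH] u.
  by rewrite has_seq1 => Du; exists u, [::], [::].
case h: (has D (v :: s)).
  by have [z [s1 [s2 [-> Dz n]]]] := IH v h; exists z, (u :: s1), s2.
by rewrite [has _ _]/= -/(has D (v :: s)) h orbF => Du; exists u, [::], (v :: s); rewrite h.
Qed.

Lemma separates_trans_dst e A B S x y W :
  separates e A B (y |: S) -> separates (remove_arc e x y) (y |: S) B W -> separates e A B W.
Proof.
move=> sep sepW u s uA pe lB.
have [z [s1 [s2 [Es zS noS]]]] := last_hit (sep u s uA pe lB).
have [pz lz] : path e z s2 /\ last z s2 \in B.
  case: s1 Es => [|w s1] /= [Eu Es]; first by rewrite -Eu -Es.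
  by move: pe lB; rewrite Es cat_path last_cat /= => /and3P[].
have ys2 : y \notin s2.
  by apply: contra noS => ys; apply/hasP; exists y => //; apply: setU11.
have /hasP[v vs vW] := sepW z s2 zS (path_remove_dst x ys2 pz) lz.
by apply/hasP; exists v => //; rewrite Es mem_cat vs orbT.
Qed.

Lemma inj_onto k (f : 'I_k -> T) (D : {set T}) : injective f -> (forall i, f i \in D) ->
  #|D| = k -> forall d, d \in D -> exists i, f i = d.
Proof.
move=> fi fD cD d dD.
have : d \in [set f i | i : 'I_k].
  suff -> : [set f i | i : 'I_k] = D by [].
  apply/eqP; rewrite eqEcard cD card_imset // card_ord leqnn andbT.
  by apply/subsetP => _ /imsetP[i _ ->].
by case/imsetP=> i _ ->; exists i.
Qed.

(* Walking along the first path up to a common vertex and then along the second one has to hit [S]. *)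
Lemma crossing e A B S a s b t v : separates e A B S ->
  a \in A -> path e a s -> uniq (a :: s) -> path e b t -> last b t \in B -> uniq (b :: t) ->
  (forall w, w \in a :: s -> w \in S -> w = last a s) ->
  (forall w, w \in b :: t -> w \in S -> w = b) ->
  v \in a :: s -> v \in b :: t -> v = last a s /\ v \in S.
Proof.
move=> sepS aA ps us pt tB ut hSi hSj vi vj.
case/splitPl: vi ps us hSi => s1 s2 e1; rewrite cat_path => /andP[ps1 _] us hSi.
case/splitPl: vj pt tB ut hSj => t1 t2 e2; rewrite cat_path last_cat e2 => /andP[_ pt2] tB ut hSj.
have : path e a (s1 ++ t2) by rewrite cat_path ps1 e1.
move/(sepS _ _ aA); rewrite last_cat e1 => /(_ tB) /hasP[w]; rewrite -cat_cons mem_cat => /orP[ws|wt] wS.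
  have wl : w = last a (s1 ++ s2) by apply: hSi => //; rewrite -cat_cons mem_cat ws.
  case: s2 us hSi wl => [|z s2] us hSi wl.
    by move: wl; rewrite cats0 e1 => wv; split=> //; rewrite -wv.
  move: us; rewrite -cat_cons cat_uniq => /and3P[_ /hasPn/(_ w) + _].
  by rewrite ws wl last_cat /= mem_last => /(_ isT).
have wb : w = b by apply: hSj => //; rewrite -cat_cons mem_cat wt orbT.
by move: ut; rewrite -cat_cons cat_uniq => /and3P[_ /hasPn/(_ _ wt)]; rewrite /= wb inE eqxx.
Qed.

(** Goering's induction on the number of arcs. If deleting the arc [xy] creates a separator [S] of
    fewer than [k] vertices, then [x |: S] and [y |: S] separate in the full graph and have exactly
    [k] vertices. Paths from [A] to the former and from the latter to [B] are glued along [S] and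
    the arc [xy]. *)
Lemma menger e A B k : (forall S, separates e A B S -> k <= #|S|) ->
  exists2 P : 'I_k -> T * seq T, forall i, linking e A B (P i) & disjoint_paths P.
Proof.
have [n] := ubnP #|[set p : T * T | e p.1 p.2]|.
elim: n e A B => // n IH e A B /ltnSE en min.
case: (pickP [pred p : T * T | e p.1 p.2]) => [[x y] /= exy|noe]; last first.
  have /min h : separates e A B (A :&: B).
    move=> u [|v s] uA /=; first by rewrite inE uA => _ ->.
    by have /= := noe (u, v) => ->.
  pose P i := (enum_val (widen_ord h i), [::] : seq T); exists P.
    by move=> i; have := enum_valP (widen_ord h i); rewrite inE /linking /= => /andP[-> ->].
  move=> i j v; rewrite /vertices /= !inE => /eqP -> /eqP/enum_val_inj/(congr1 val)/= ij.
  exact: val_inj.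
pose e' := remove_arc e x y.
have en' : #|[set p : T * T | e' p.1 p.2]| < n.
  apply: leq_trans en; apply: proper_card; apply/properP; split.
    by apply/subsetP => -[a b]; rewrite !inE => /andP[].
  by exists (x, y); rewrite inE //= /e' /remove_arc eqxx andbF.
have sub k' (P : 'I_k' -> T * seq T) A' B' : (forall i, linking e' A' B' (P i)) ->
    forall i, [/\ (P i).1 \in A', path e (P i).1 (P i).2, path e' (P i).1 (P i).2,
      last (P i).1 (P i).2 \in B' & uniq (vertices (P i))].
  by move=> h i; have /and4P[? hp ? ?] := h i; split=> //; apply: remove_arc_path hp.
have [min'|] := pselect (forall S, separates e' A B S -> k <= #|S|).
  have [P hP dP] := IH e' A B en' min'; exists P => // i.
  by have [h1 h2 _ h3 h4] := sub _ _ _ _ hP i; rewrite /linking h1 h2 h3 h4.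
move=> /existsNP[S /not_implyP[sepS /negP]]; rewrite -ltnNge => Sk.
have sx := separates_src sepS; have sy := separates_dst sepS.
have card_x : #|x |: S| = k /\ x \notin S.
  by have := min _ sx; rewrite cardsU1; case: (x \in S) => /=; lia.
have card_y : #|y |: S| = k /\ y \notin S.
  by have := min _ sy; rewrite cardsU1; case: (y \in S) => /=; lia.
have [P hP dP] := IH e' A (x |: S) en' (fun W h => min _ (separates_trans_src sx h)).
have [Q hQ dQ] := IH e' (y |: S) B en' (fun W h => min _ (separates_trans_dst sy h)).
pose lx i := last (P i).1 (P i).2; pose hy j := (Q j).1.
have subP := sub _ _ _ _ hP; have subQ := sub _ _ _ _ hQ.
have lxP i : lx i \in vertices (P i) by apply: mem_last.
have hyQ j : hy j \in vertices (Q j) by apply: mem_head.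
have lx_in i : lx i \in x |: S by case: (subP i).
have hy_in j : hy j \in y |: S by case: (subQ j).
have lx_inj l l' : lx l = lx l' -> l = l'.
  by move=> h; apply: (dP _ _ (lx l)) => //; rewrite h.
have hy_inj l l' : hy l = hy l' -> l = l'.
  by move=> h; apply: (dQ _ _ (hy l)) => //; rewrite h.
have lx_onto := inj_onto lx_inj lx_in card_x.1.
have hy_onto := inj_onto hy_inj hy_in card_y.1.
have P_last i v : v \in vertices (P i) -> v \in x |: S -> v = lx i.
  by move=> vi /lx_onto[i' ei]; rewrite -ei; congr lx; apply: (dP _ _ v) => //; rewrite -ei.
have Q_head j v : v \in vertices (Q j) -> v \in y |: S -> v = hy j.
  by move=> vj /hy_onto[j' ej]; rewrite -ej; congr hy; apply: (dQ _ _ v) => //; rewrite -ej.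
have cross i j v : v \in vertices (P i) -> v \in vertices (Q j) ->
    [/\ v = lx i, v = hy j & v \in S].
  move=> vi vj.
  have [uA _ pP _ uP] := subP i; have [_ _ pQ lB uQ] := subQ j.
  have [||vx vS] := crossing sepS uA pP uP pQ lB uQ _ _ vi vj.
  - by move=> w h1 h2; apply/P_last/setU1r.
  - by move=> w h1 h2; apply/Q_head/setU1r.
  by split=> //; apply: Q_head => //; apply: setU1r.
have next i : exists j, hy j = if lx i == x then y else lx i.
  apply: hy_onto; case: eqP => [_|/eqP nx]; first exact: setU11.
  by apply: setU1r; have := lx_in i; rewrite in_setU1 (negPf nx).
have [jf hjf] := choice next.
(* Across the arc [xy] the whole second path is appended; otherwise its first vertex is already the
   last one of [P i]. *)
pose R i := ((P i).1, (P i).2 ++ if lx i == x then vertices (Q (jf i)) else (Q (jf i)).2).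
have R_sub i v : v \in vertices (R i) -> v \in vertices (P i) \/
    v \in vertices (Q (jf i)) /\ (lx i != x -> v \in (Q (jf i)).2).
  rewrite /R /vertices /= inE mem_cat orbA => /orP[h|h]; first by left; rewrite inE.
  right; case: ifP h => [_ h|_ h]; first by split.
  by split=> //; rewrite inE h orbT.
apply: (@shorten_paths e A B k R) => [i|].
  have [hA pP _ _ _] := subP i; have [_ pQ _ lB _] := subQ (jf i).
  rewrite /R /= hA cat_path last_cat pP -/(lx i) /=.
  have := hjf i; rewrite /hy /vertices; case: eqP => [-> hq|_ hq].
    by rewrite /= hq exy -hq pQ.
  by rewrite -hq pQ.
move=> i i' v /R_sub hi /R_sub hi'.
have lx_S l : lx l != x -> lx l \in S by move=> n1; have := lx_in l; rewrite in_setU1 (negPf n1).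
have jf_inj : jf i = jf i' -> i = i'.
  move=> ej; have := hjf i; rewrite ej hjf => h; apply: lx_inj; move: h.
  case: eqP => [-> |/eqP/lx_S i'S]; case: eqP => [-> //|/eqP/lx_S iS] h //.
    by move: iS; rewrite -h (negPf card_y.2).
  by move: i'S; rewrite h (negPf card_y.2).
have mixed l l' : v \in vertices (P l) -> v \in vertices (Q (jf l')) ->
    (lx l' != x -> v \in (Q (jf l')).2) -> l = l'.
  move=> vl vl' tl; have [v1 v2 vS] := cross _ _ _ vl vl'.
  have := hjf l'; rewrite -v2; case: eqP => [_ vy|/eqP/tl h _].
    by move: vS; rewrite vy (negPf card_y.2).
  have [_ _ _ _] := subQ (jf l'); rewrite /vertices /= -/(hy _) -v2 => /andP[].
  by rewrite h.
case: hi hi' => [vi|[vi ti]] [vi'|[vi' ti']].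
- exact: dP vi vi'.
- exact: mixed vi vi' ti'.
- by apply/esym; apply: mixed vi' vi ti.
- by apply: jf_inj; apply: dQ vi vi'.
Qed.
End Menger.

(** * Linking two longest cycles *)

Section Connectivity.
Variables (T : finType) (e : rel T) (r : nat).
Hypotheses (sg : simple_graph e) (rc : r_connected r e).

Let esym : symmetric e := proj1 sg.
Let eirr : irreflexive e := proj2 sg.

(** Deleting all neighbours isolates [x], and if there were fewer than [r] of them, a further vertex
    would remain. *)
Lemma r_connected_degree x : r <= #|[set y | e x y]|.
Proof.
rewrite leqNgt; apply/negP => small.
set S := [set y | e x y] in small.
have xS : x \notin S by rewrite inE eirr.
have [z] : exists z, z \notin x |: S.
  apply/existsP; rewrite -[X in is_true X]negbK negb_exists; apply/negP => /forallP all_in.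
  have : #|T| <= #|x |: S|.
    by apply: subset_leq_card; apply/subsetP => z _; have := all_in z; rewrite negbK.
  by have := rc.1; rewrite cardsU1 xS; lia.
rewrite in_setU1 negb_or => /andP[zx zS].
have /connectP[[|w s] /=] := rc.2 S small x z xS zS; first by move=> _ zE; rewrite zE eqxx in zx.
by case/andP=> /and3P[_ + xw] _; rewrite inE xw.
Qed.

(** All neighbours of the first vertex of a longest path lie on it; the edge to the farthest one
    closes a cycle through that vertex and at least [r] neighbours. Hence fewer than [r] vertices
    never cover a longest cycle. *)
Lemma r_connected_long_cycle : 2 <= r -> exists2 c, is_cycle e c & r < size c.
Proof.
move=> r2.
pose good n := `[< exists x s, [/\ path e x s, uniq (x :: s) & size s = n] >].
have ex : exists n, good n.
  have [x _] : exists x : T, true by move: rc.1; case: (pickP T) => [x _ _|/eq_card0 ->]; [exists x|].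
  by exists 0; apply/asboolP; exists x, [::].
have bnd n : good n -> n <= #|T|.
  move/asboolP => [x [s [_ /card_uniqP us <-]]].
  by apply: leq_trans (leqnSn _) _; rewrite -[(size s).+1]us max_card.
case: (ex_maxnP ex bnd) => n /asboolP[x [s [ps us sn]]] nmax.
have nb y : e x y -> y \in s.
  move=> xy; apply: contraT => ys.
  have := nmax n.+1; rewrite ltnn => /(_ _)/negP[] //; apply/asboolP.
  exists y, (x :: s); split; [by rewrite /= esym xy| |by rewrite /= sn].
  by rewrite cons_uniq inE negb_or ys us !andbT; apply: contraTneq xy => ->; rewrite eirr.
have deg := r_connected_degree x.
have [y0 xy0] : exists y, y \in [set y | e x y] by apply/card_gt0P; lia.
have [y xy ymax] := @arg_maxnP _ y0 (mem [set y | e x y]) (index^~ s) xy0.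
rewrite !inE in xy.
pose t := take (index y s).+1 s.
have ys := nb _ xy.
have st : size t = (index y s).+1 by rewrite size_takel // index_mem.
have tE : t = rcons (take (index y s) s) y by rewrite /t (take_nth y) ?index_mem // nth_index.
have sz : r <= size t.
  apply: leq_trans deg _; apply: leq_trans (card_size t).
  apply: subset_leq_card; apply/subsetP => z; rewrite inE => xz.
  rewrite /t in_take_leq ?index_mem // ltnS.
  by have zS : z \in [set y | e x y] by [rewrite inE]; apply: ymax zS.
exists (x :: t); last by rewrite /= ltnS.
split; first by rewrite /= ltnS; apply: leq_trans sz.
rewrite /ucycle; apply/andP; split.
  rewrite /= rcons_path; apply/andP; split; first by rewrite /t; apply: take_path.
  by rewrite tE last_rcons esym.
by move: us; rewrite /= => /andP[xs us']; rewrite take_uniq // andbT; apply: contra xs => /mem_take.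
Qed.
End Connectivity.

(** [m] is the stretch since the last visit to [c1]: at a new vertex of [c1] the search restarts, at
    a vertex of [c2] it stops. *)
Lemma trim_path (T : eqType) (e : rel T) (c1 c2 : seq T) s a m :
  a \in c1 -> (forall v, v \in m -> v \notin c1 /\ v \notin c2) ->
  (forall v, v \in a :: m ++ s -> ~~ ((v \in c1) && (v \in c2))) ->
  path e a (m ++ s) -> last a (m ++ s) \in c2 ->
  exists a' m' b', [/\ a' \in c1, b' \in c2, forall v, v \in m' -> v \notin c1 /\ v \notin c2,
    path e a' (rcons m' b') & subseq (a' :: rcons m' b') (a :: m ++ s)].
Proof.
elim: s a m => [|z s IH] a m ac clean nob pe.
  rewrite cats0; case/lastP: m clean nob {pe} => [|m w] clean nob /=.
    by move=> ac2; have := nob a; rewrite inE eqxx ac ac2 => /(_ isT).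
  by rewrite last_rcons => wc; have [] := clean w; rewrite ?mem_rcons ?inE ?eqxx // wc.
move=> lc.
have zin : z \in a :: m ++ z :: s by rewrite inE mem_cat inE eqxx !orbT.
have [zc1|zc1] := boolP (z \in c1).
  have [||||a' [m' [b' [h1 h2 h3 h4 h5]]]] := IH z [::] zc1.
  - by [].
  - by move=> v hv; apply: nob; rewrite inE mem_cat hv !orbT.
  - by move: pe; rewrite cat_path /= => /and3P[].
  - by move: lc; rewrite last_cat.
  exists a', m', b'; split=> //; apply: subseq_trans h5 _.
  exact: (suffix_subseq (a :: m) (z :: s)).
have [zc2|zc2] := boolP (z \in c2).
  exists a, m, z; split=> //.
    by move: pe; rewrite -cat_rcons cat_path => /andP[].
  by rewrite -cat_rcons -cat_cons prefix_subseq.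
have [||||a' [m' [b' h]]] := IH a (rcons m z) ac; rewrite ?cat_rcons //.
  by move=> v; rewrite mem_rcons inE => /orP[/eqP ->|/clean].
by exists a', m', b'; move: h; rewrite cat_rcons.
Qed.

Section LongestCycles.
Variables (T : finType) (e : rel T) (r : nat).
Hypotheses (sg : simple_graph e) (rc : r_connected r e) (r2 : 2 <= r).
Variables c1 c2 : seq T.
Hypotheses (lc1 : longest_cycle e c1) (lc2 : longest_cycle e c2).

Let esym : symmetric e := proj1 sg.

Let common := #|[set x in c1] :&: [set x in c2]|.

Lemma longest_uniq_cycle c : longest_cycle e c -> uniq c /\ cycle e c.
Proof. by move=> [[_ /andP[]]]. Qed.

Lemma longest_size c : longest_cycle e c -> r < size c.
Proof.
move=> [_ cmax]; have [c' c'_cyc c'_size] := r_connected_long_cycle sg rc r2.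
exact: leq_trans c'_size (cmax _ c'_cyc).
Qed.

(** Lists of at most two vertices fail [is_cycle] but are short anyway, so a rerouted list needs no
    lower bound on its size. *)
Lemma longest_max c : longest_cycle e c ->
  forall D, uniq D -> cycle e D -> size D <= size c.
Proof.
move=> [[c3 _] cmax] D uD cD; case: (leqP (size D) 2) => h; last by apply: cmax; rewrite /is_cycle /ucycle cD uD.
exact: leq_trans h (ltnW c3).
Qed.

Lemma cycles_not_separated S : separates e [set x in c1] [set x in c2] S -> r <= #|S|.
Proof.
move=> sepS; rewrite leqNgt; apply/negP => small.
have outside c : longest_cycle e c -> exists2 x, x \in c & x \notin S.
  move=> lc; have [uc _] := longest_uniq_cycle lc.
  have : ~~ ([set x in c] \subset S).
    apply: contraL (longest_size lc) => /subset_leq_card.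
    by rewrite cardsE (card_uniqP uc) => h; rewrite -leqNgt; apply: leq_trans h (ltnW small).
  by case/subsetPn=> x; rewrite inE; exists x.
have [x xc xS] := outside _ lc1; have [y yc yS] := outside _ lc2.
have /connectP[s ps yl] := rc.2 S small x y xS yS.
have pe : path e x s by apply: sub_path ps => a b /and3P[].
have /hasP[z zs zS'] : has (mem S) (x :: s) by apply: sepS; rewrite ?inE // -yl.
have zS : z \in S by [].
move: zs; rewrite inE => /orP[/eqP zx|zs]; first by rewrite -zx zS in xS.
move: ps; case/splitPr: zs => s1 s2; rewrite cat_path /= => /and3P[_ /and3P[_ + _] _].
by rewrite zS.
Qed.

(** Of the [r] disjoint paths, each one through a common vertex has such a vertex to itself; so at
    most [common] are discarded, and the others are trimmed. *)
Lemma linkage_exists : exists (I : finType) (a b : I -> T) (mid : I -> seq T),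
  linkage e c1 c2 a b mid /\ r <= #|I| + common.
Proof.
have [P hP dP] := menger cycles_not_separated.
pose both v := (v \in c1) && (v \in c2).
pose Tr := [set i | has both (vertices (P i))].
have TrS : #|Tr| <= common.
  pose f i := nth (P i).1 (vertices (P i)) (find both (vertices (P i))).
  have fP i : i \in Tr -> f i \in vertices (P i) /\ both (f i).
    by rewrite inE => h; rewrite /f nth_find // mem_nth // -has_find.
  rewrite -(card_in_imset (f := f)).
    by apply: subset_leq_card; apply/subsetP => _ /imsetP[i /fP[_ h] ->]; rewrite !inE.
  move=> i j /fP[hi _] /fP[hj _] h; apply: dP hi _; by rewrite h.
pose I := {i : 'I_r | i \notin Tr}.
have cardI : r <= #|{: I}| + common.
  rewrite card_sig -[X in X <= _](card_ord r) -(cardC (mem Tr)) addnC.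
  by apply: leq_add => //; apply: subset_leq_card; apply/subsetP => i; rewrite !inE.
have ex (i : I) : exists abm : T * T * seq T,
    [/\ abm.1.1 \in c1, abm.1.2 \in c2, forall v, v \in abm.2 -> v \notin c1 /\ v \notin c2,
      path e abm.1.1 (rcons abm.2 abm.1.2) &
      subseq (abm.1.1 :: rcons abm.2 abm.1.2) (vertices (P (val i)))].
  have := valP i; rewrite /= inE => /hasPn nob.
  have /and4P[xA px lB ux] := hP (val i).
  have [|||||a' [m' [b' [h1 h2 h3 h4 h5]]]] := @trim_path _ e c1 c2 (P (val i)).2 (P (val i)).1 [::].
  - by rewrite inE in xA.
  - by [].
  - exact: nob.
  - exact: px.
  - by move: lB; rewrite inE.
  by exists (a', b', m').
have [g hg] := choice ex.
exists I, (fun i => (g i).1.1), (fun i => (g i).1.2), (fun i => (g i).2); split=> //.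
have sub i v : v \in (g i).1.1 :: rcons (g i).2 (g i).1.2 -> v \in vertices (P (val i)).
  by case: (hg i) => _ _ _ _ /mem_subseq; apply.
have nob i v : v \in (g i).1.1 :: rcons (g i).2 (g i).1.2 -> ~~ both v.
  by move=> /sub; have := valP i; rewrite /= inE => /hasPn; apply.
have same i j v : v \in (g i).1.1 :: rcons (g i).2 (g i).1.2 ->
    v \in (g j).1.1 :: rcons (g j).2 (g j).1.2 -> i = j.
  by move=> /sub vi /sub vj; apply: val_inj; apply: dP vi vj.
have src i : (g i).1.1 \in (g i).1.1 :: rcons (g i).2 (g i).1.2 by apply: mem_head.
have dst i : (g i).1.2 \in (g i).1.1 :: rcons (g i).2 (g i).1.2.
  by rewrite inE mem_rcons mem_head orbT.
have mid i v : v \in (g i).2 -> v \in (g i).1.1 :: rcons (g i).2 (g i).1.2.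
  by move=> h; rewrite inE mem_rcons inE h !orbT.
split.
- by move=> i; case: (hg i).
- by move=> i; case: (hg i) => h _ _ _ _; split=> //; have := nob _ _ (src i); rewrite /both h.
- by move=> i; case: (hg i) => _ h _ _ _; split=> //; have := nob _ _ (dst i); rewrite /both h andbT.
- by move=> i v; case: (hg i) => _ _ h _ _; apply: h.
- move=> i; have /and4P[_ _ _ u] := hP (val i); case: (hg i) => _ _ _ _ /subseq_uniq/(_ u).
  by rewrite /= rcons_uniq => /and3P[].
- by move=> i j h; apply: same (src i) _; rewrite h.
- by move=> i j h; apply: same (dst i) _; rewrite h.
- by move=> i j v /mid vi /mid vj; apply: same vi vj.
Qed.

End LongestCycles.

Lemma seg_le_common (T : finType) (c c' : seq T) v : uniq c -> seg c c' v <= #|[set x in c] :&: [set x in c']|.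
Proof.
move=> uc; apply: leq_trans (_ : count (mem c') c <= _).
  by rewrite -{2}(cat_take_drop (index v c) c) count_cat leq_addr.
rewrite -size_filter -(card_uniqP (filter_uniq _ uc)); apply: subset_leq_card.
by apply/subsetP => x; rewrite mem_filter !inE andbC.
Qed.

(** * Counting *)

Section GirthEight.
Variables (U V : finType) (F : U -> V -> bool) (SU : {set U}) (SV : {set V}).
Hypothesis F_in : forall u v, F u v -> u \in SU /\ v \in SV.
Hypothesis no_C4 : forall u u' v v', u != u' -> v != v' ->
  F u v -> F u v' -> F u' v -> F u' v' -> False.
Hypothesis no_C6 : forall u1 u2 u3 v1 v2 v3,
  u1 != u2 -> u1 != u3 -> u2 != u3 -> v1 != v2 -> v1 != v3 -> v2 != v3 ->
  F u1 v2 -> F u1 v3 -> F u2 v1 -> F u2 v3 -> F u3 v1 -> F u3 v2 -> False.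

Let du u := #|[set v | F u v]|.
Let dv v := #|[set u | F u v]|.
Let E := \sum_u \sum_v F u v.

Let sum_card (X : finType) (P : pred X) : \sum_x (P x : nat) = #|[set x | P x]|.
Proof. by rewrite -sum1_card [RHS]big_mkcond; apply: eq_bigr => x _; rewrite inE; case: (P x). Qed.

(* By the girth condition a path of length three is determined by its ends. *)
Lemma three_paths : \sum_u \sum_v F u v * ((du u).-1 * (dv v).-1) <= #|SU| * #|SV|.
Proof.
pose Q u v u' v' := [&& F u v, F u v' && (v' != v) & F u' v && (u' != u)].
have -> : \sum_u \sum_v F u v * ((du u).-1 * (dv v).-1) =
    \sum_u \sum_v \sum_u' \sum_v' Q u v u' v'.
  apply: eq_bigr => u _; apply: eq_bigr => v _.
  case Fuv: (F u v); last first.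
    by rewrite mul0n big1 // => u' _; rewrite big1 // => v' _; rewrite /Q Fuv.
  rewrite mul1n.
  have -> : (du u).-1 = \sum_v' (F u v' && (v' != v)).
    rewrite sum_card /du (cardsD1 v) inE Fuv add1n /=; congr #|pred_of_set _|.
    by apply/setP => v'; rewrite !inE andbC.
  have -> : (dv v).-1 = \sum_u' (F u' v && (u' != u)).
    rewrite sum_card /dv (cardsD1 u) inE Fuv add1n /=; congr #|pred_of_set _|.
    by apply/setP => u'; rewrite !inE andbC.
  rewrite mulnC big_distrl; apply: eq_bigr => u' _; rewrite big_distrr; apply: eq_bigr => v' _.
  by rewrite /Q Fuv /= mulnb andbC.
under eq_bigr => u _ do rewrite exchange_big.
rewrite exchange_big.
under eq_bigr => u' _ do under eq_bigr => u _ do rewrite exchange_big.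
under eq_bigr => u' _ do rewrite exchange_big.
have -> : #|SU| * #|SV| = \sum_u' \sum_v' ((u' \in SU) && (v' \in SV) : nat).
  rewrite -[#|SU|]sum1_card -[#|SV|]sum1_card big_distrlr /= big_mkcond.
  apply: eq_bigr => u' _; case: (u' \in SU); last by rewrite big1.
  by rewrite big_mkcond; apply: eq_bigr => v' _; case: (v' \in SV).
apply: leq_sum => u' _; apply: leq_sum => v' _.
rewrite pair_big sum_card /=.
case Euv: ((u' \in SU) && (v' \in SV)); last first.
  rewrite leqn0 cards_eq0; apply/eqP/setP => -[u v]; rewrite !inE /=.
  by apply/negP => /and3P[_ /andP[/F_in[_ h] _] /andP[/F_in[h' _] _]]; rewrite h h' in Euv.
apply/card_le1_eqP => -[u1 v1] [u2 v2]; rewrite !inE /Q /=.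
move=> /and3P[f1 /andP[f1' n1] /andP[f1'' m1]] /and3P[f2 /andP[f2' n2] /andP[f2'' m2]].
have [eu|nu] := eqVneq u1 u2; have [ev|nv] := eqVneq v1 v2.
- by rewrite eu ev.
- by case: (@no_C4 u' u1 v1 v2) => //; rewrite eu.
- by case: (@no_C4 u1 u2 v' v1) => //; rewrite ev.
- by case: (@no_C6 u' u1 u2 v' v2 v1) => //; rewrite // 1?eq_sym.
Qed.

(** Vertices of degree below a quarter of the average carry at most a quarter of the edges on either
    side. Each edge of the remaining half is the middle of at least [E^2 / (64 p q)] paths of length
    three, and there are at most [p q] such paths. *)
Lemma girth_eight_edges : [\/ E <= 8 * #|SU|, E <= 8 * #|SV| | E ^ 3 <= 128 * (#|SU| * #|SV|) ^ 2].
Proof.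
set p := #|SU|; set q := #|SV|.
case: (leqP E (8 * p)) => hp; first by constructor 1.
case: (leqP E (8 * q)) => hq; first by constructor 2.
constructor 3.
have Ep : E = \sum_(u in SU) du u.
  rewrite /E [RHS]big_mkcond; apply: eq_bigr => u _; rewrite sum_card.
  case: ifPn => // hu; apply/eqP; rewrite cards_eq0; apply/eqP/setP => v; rewrite !inE.
  by apply: contraNF hu => /F_in[].
have Eq : E = \sum_(v in SV) dv v.
  rewrite /E exchange_big [RHS]big_mkcond; apply: eq_bigr => v _; rewrite sum_card.
  case: ifPn => // hv; apply/eqP; rewrite cards_eq0; apply/eqP/setP => u; rewrite !inE.
  by apply: contraNF hv => /F_in[].
pose bu u := 4 * p * du u < E; pose bv v := 4 * q * dv v < E.
have badu : 4 * \sum_u \sum_v (F u v && bu u) <= E.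
  have p0 : 0 < p.
    by rewrite lt0n; apply: contraTneq hp => p0; rewrite -leqNgt Ep /p (cards0_eq p0) big_set0.
  rewrite -(leq_pmul2l p0) mulnA [p * 4]mulnC.
  have -> : \sum_u \sum_v (F u v && bu u) = \sum_(u in SU | bu u) du u.
    rewrite [RHS]big_mkcond; apply: eq_bigr => u _; case hb: (bu u); last first.
      by rewrite andbF big1 // => v _; rewrite andbF.
    rewrite andbT; under eq_bigr do rewrite andbT; rewrite sum_card.
    case: ifPn => // hu; apply/eqP; rewrite cards_eq0; apply/eqP/setP => v; rewrite !inE.
    by apply: contraNF hu => /F_in[].
  rewrite big_distrr /= -[X in _ <= X * _]sum1_card big_distrl /=.
  rewrite [leqRHS](bigID bu) /=; apply: leq_trans (leq_addr _ _).
  by apply: leq_sum => u /andP[_ /ltnW]; rewrite mul1n.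
have badv : 4 * \sum_u \sum_v (F u v && bv v) <= E.
  have q0 : 0 < q.
    by rewrite lt0n; apply: contraTneq hq => q0; rewrite -leqNgt Eq /q (cards0_eq q0) big_set0.
  rewrite -(leq_pmul2l q0) mulnA [q * 4]mulnC.
  have -> : \sum_u \sum_v (F u v && bv v) = \sum_(v in SV | bv v) dv v.
    rewrite exchange_big [RHS]big_mkcond; apply: eq_bigr => v _; case hb: (bv v); last first.
      by rewrite andbF big1 // => u _; rewrite andbF.
    rewrite andbT; under eq_bigr do rewrite andbT; rewrite sum_card.
    case: ifPn => // hv; apply/eqP; rewrite cards_eq0; apply/eqP/setP => u; rewrite !inE.
    by apply: contraNF hv => /F_in[].
  rewrite big_distrr /= -[X in _ <= X * _]sum1_card big_distrl /=.
  rewrite [leqRHS](bigID bv) /=; apply: leq_trans (leq_addr _ _).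
  by apply: leq_sum => v /andP[_ /ltnW]; rewrite mul1n.
pose G := \sum_u \sum_v (F u v && (~~ bu u && ~~ bv v)).
have EG : E <= 2 * G.
  have : E <= G + (\sum_u \sum_v (F u v && bu u) + \sum_u \sum_v (F u v && bv v)).
    rewrite -!big_split /=; apply: leq_sum => u _; rewrite -!big_split /=; apply: leq_sum => v _.
    by case: (F u v) (bu u) (bv v) => [] [] [].
  by move: badu badv; lia.
have step : G * E ^ 2 <= 64 * p * q * \sum_u \sum_v F u v * ((du u).-1 * (dv v).-1).
  rewrite /G big_distrl big_distrr /=; apply: leq_sum => u _.
  rewrite big_distrl big_distrr /=; apply: leq_sum => v _.
  case hF: (F u v) => //=; case hb: (bu u) => //=; case hb': (bv v) => //=.
  rewrite !mul1n.
  (* As [E > 8 p], the degree exceeds 2, and subtracting 1 from it costs at most a factor 2. *)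
  have hu : E <= 8 * p * (du u).-1 by move: hb; rewrite /bu; nia.
  have hv : E <= 8 * q * (dv v).-1 by move: hb'; rewrite /bv; nia.
  have := leq_mul hu hv; rewrite mulnn => /leq_trans; apply.
  by rewrite leq_eqVlt; apply/orP; left; apply/eqP; lia.
have h3 := three_paths; rewrite -/p -/q in h3.
have : E ^ 3 <= 2 * (64 * p * q * (p * q)).
  apply: leq_trans (_ : 2 * (G * E ^ 2) <= _).
    by rewrite expnS mulnA leq_mul2r EG orbT.
  by rewrite leq_mul2l /=; apply: leq_trans step _; rewrite leq_mul2l h3 orbT.
by move/leq_trans; apply; rewrite -mulnn; lia.
Qed.
End GirthEight.

Import Order.TTheory GRing.Theory Num.Theory.
Local Open Scope ring_scope.

Lemma weighted_Cauchy_Schwarz (R : realFieldType) (J : finType) (a b : J -> R) :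
  (forall j, 0 <= a j) ->
  (\sum_j a j * b j) ^+ 2 <= (\sum_j a j) * \sum_j a j * b j ^+ 2.
Proof.
move=> a0.
have : 0 <= \sum_i \sum_j a i * a j * (b i - b j) ^+ 2.
  by apply: sumr_ge0 => i _; apply: sumr_ge0 => j _; apply: mulr_ge0; [apply: mulr_ge0|apply: sqr_ge0].
have -> : \sum_i \sum_j a i * a j * (b i - b j) ^+ 2 =
    (\sum_j a j * b j ^+ 2) * (\sum_j a j) + (\sum_j a j) * (\sum_j a j * b j ^+ 2)
    - (\sum_j a j * b j) * (\sum_j a j * b j) *+ 2.
  rewrite !big_distrlr /= -sumrMnl -big_split -sumrB /=; apply: eq_bigr => i _.
  by rewrite -sumrMnl -big_split -sumrB /=; apply: eq_bigr => j _; ring.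
rewrite expr2; lra.
Qed.

(** * The weighted number of quadrilaterals, with cube roots [u], [v] of the degrees *)

Section QuadCount.
Variables (R : realFieldType) (A B : finType) (m : A -> B -> bool).
Variables (u : A -> R) (v : B -> R) (n1 T : R).
Let w x y : R := (m x y)%:R.
Let e := \sum_x \sum_y w x y.
Hypothesis n1_ge0 : 0 <= n1.
Hypotheses (u_ge0 : forall x, 0 <= u x) (v_ge0 : forall y, 0 <= v y).
Hypothesis u_cube : forall x, u x ^+ 3 = \sum_y w x y.
Hypothesis v_cube : forall y, v y ^+ 3 = \sum_x w x y.
Hypotheses (u_le : forall x, u x <= n1) (v_le : forall y, v y <= n1).
Hypotheses (u_sum : \sum_x u x <= T) (v_sum : \sum_y v y <= T).

Let quads x y := \sum_b \sum_a w x a * w b y * w b a.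

Variable K : R.
Hypothesis K_ge0 : 0 <= K.
Hypothesis quads_le : forall x y, m x y ->
  quads x y <= K * (u x ^+ 3 + v y ^+ 3 + u x ^+ 2 * v y ^+ 2).

Let w_ge0 x y : 0 <= w x y. Proof. exact: ler0n. Qed.

Let w_u x y : w x y != 0 -> 0 < u x.
Proof.
move=> h; rewrite lt0r u_ge0 andbT; apply: contraNneq h => u0.
have := u_cube x; rewrite u0 expr0n /= => /esym/eqP.
by rewrite psumr_eq0 // => /allP/(_ y)/(_ (mem_index_enum _)).
Qed.

Let w_v x y : w x y != 0 -> 0 < v y.
Proof.
move=> h; rewrite lt0r v_ge0 andbT; apply: contraNneq h => v0.
have := v_cube y; rewrite v0 expr0n /= => /esym/eqP.
by rewrite psumr_eq0 // => /allP/(_ x)/(_ (mem_index_enum _)).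
Qed.

Let T_ge0 : 0 <= T.
Proof. by apply: le_trans u_sum; apply: sumr_ge0. Qed.

Let weight x b y a := w x y * w x a * w b y * w b a / (u x * u b * v y * v a).
Let Q := \sum_x \sum_b \sum_y \sum_a weight x b y a.

(** Cauchy-Schwarz twice: over the vertices [x] with weight [u x], as [e] is the sum of
    [u x * u x ^+ 2], then over the pairs [y], [a] with weight [v y * v a]. *)
Lemma edges_le_Q : e ^+ 4 <= T ^+ 4 * Q.
Proof.
(* Paths [y], [x], [a] weighted by the inverse of [u x]; the total of [c] is the sum of all
   [u x ^+ 5]. *)
pose c y a := \sum_x w x y * w x a / u x.
have c_ge0 y a : 0 <= c y a.
  by apply: sumr_ge0 => x _; rewrite !mulr_ge0 ?invr_ge0.
have step1 : e ^+ 2 <= T * \sum_y \sum_a c y a.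
  have -> : e = \sum_x u x * u x ^+ 2.
    by apply: eq_bigr => x _; rewrite -exprS u_cube.
  apply: le_trans (weighted_Cauchy_Schwarz _ u_ge0) _.
  have -> : \sum_y \sum_a c y a = \sum_x u x * (u x ^+ 2) ^+ 2.
    rewrite /c; under eq_bigr => y _ do rewrite exchange_big /=.
    rewrite exchange_big /=; apply: eq_bigr => x _.
    have [u0|u0] := eqVneq (u x) 0.
      by rewrite u0 mul0r big1 // => y _; rewrite big1 // => a _; rewrite invr0 mulr0.
    have -> : u x * (u x ^+ 2) ^+ 2 = (u x ^+ 3) * (u x ^+ 3) / u x by field.
    rewrite u_cube big_distrlr /= mulr_suml; apply: eq_bigr => y _.
    by rewrite mulr_suml.
  by apply: ler_wpM2r => //; apply: sumr_ge0 => x _; rewrite mulr_ge0 // exprn_ge0 // exprn_ge0.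
have cE y a : c y a = v y * v a * (c y a / (v y * v a)).
  have [v0|v0] := eqVneq (v y * v a) 0; last by rewrite mulrCA divff // mulr1.
  rewrite v0 mul0r /c big1 // => x _.
  have [->|/w_v wy] := eqVneq (w x y) 0; first by rewrite !mul0r.
  have [->|/w_v wa] := eqVneq (w x a) 0; first by rewrite mulr0 mul0r.
  by move: v0 => /eqP; rewrite mulf_eq0 !gt_eqF.
have step2 : (\sum_y \sum_a c y a) ^+ 2 <= T ^+ 2 * Q.
  rewrite pair_big /=; under eq_bigr => p _ do rewrite cE.
  apply: le_trans (weighted_Cauchy_Schwarz (fun p : B * B => c p.1 p.2 / (v p.1 * v p.2)) _) _.
    by move=> p; rewrite mulr_ge0.
  have -> : \sum_(p : B * B) v p.1 * v p.2 = (\sum_y v y) ^+ 2.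
    by rewrite expr2 big_distrlr /= pair_big.
  have -> : \sum_(p : B * B) v p.1 * v p.2 * (c p.1 p.2 / (v p.1 * v p.2)) ^+ 2 = Q.
    rewrite -(pair_big xpredT xpredT (fun y a => v y * v a * (c y a / (v y * v a)) ^+ 2)) /= /Q.
    under [RHS]eq_bigr => x _ do rewrite exchange_big /=.
    rewrite [RHS]exchange_big /=; apply: eq_bigr => y _.
    under [RHS]eq_bigr => x _ do rewrite exchange_big /=.
    rewrite [RHS]exchange_big /=; apply: eq_bigr => a _.
    have -> : v y * v a * (c y a / (v y * v a)) ^+ 2 = c y a * c y a / (v y * v a).
      have [v0|v0] := eqVneq (v y * v a) 0; first by rewrite v0 mul0r invr0 mulr0.
      by move: v0; rewrite mulf_eq0 negb_or => /andP[vy va]; field; rewrite vy va.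
    rewrite /c big_distrlr /= mulr_suml; apply: eq_bigr => x _.
    rewrite mulr_suml; apply: eq_bigr => b _; rewrite /weight.
    by rewrite !invfM; ring.
  apply: ler_wpM2r.
    apply: sumr_ge0 => x _; apply: sumr_ge0 => b _; apply: sumr_ge0 => y _; apply: sumr_ge0 => a _.
    by rewrite /weight !mulr_ge0 // invr_ge0 !mulr_ge0.
  by rewrite ler_pXn2r ?nnegrE ?sumr_ge0.
have -> : e ^+ 4 = (e ^+ 2) ^+ 2 by rewrite -exprM.
have -> : T ^+ 4 * Q = T ^+ 2 * (T ^+ 2 * Q) by rewrite mulrA -exprD.
have cc : 0 <= \sum_y \sum_a c y a by apply: sumr_ge0 => y _; apply: sumr_ge0.
apply: le_trans (_ : (T * \sum_y \sum_a c y a) ^+ 2 <= _).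
  by rewrite ler_pXn2r ?nnegrE ?exprn_even_ge0 ?mulr_ge0.
by rewrite exprMn; apply: ler_wpM2l => //; apply: exprn_ge0.
Qed.

(** The weight splits into factors for the opposite edges [xy] and [ba]. The inequality of
    arithmetic and geometric means separates them, and by symmetry both halves have the same sum. *)
Lemma Q_le : Q <= \sum_x \sum_y w x y * quads x y / (u x * v y) ^+ 2.
Proof.
have amgm x b y a : weight x b y a <=
    (w x y * w x a * w b y * w b a / (u x * v y) ^+ 2 + w x y * w x a * w b y * w b a / (u b * v a) ^+ 2) / 2%:R.
  rewrite /weight; set k := w x y * _ * _ * _.
  have k0 : 0 <= k by rewrite !mulr_ge0.
  set s := (u x * v y)^-1; set t := (u b * v a)^-1.
  have -> : k / (u x * u b * v y * v a) = k * (s * t) by rewrite /s /t !invfM; ring.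
  have -> : k / (u x * v y) ^+ 2 = k * s ^+ 2 by rewrite /s exprVn.
  have -> : k / (u b * v a) ^+ 2 = k * t ^+ 2 by rewrite /t exprVn.
  have := mulr_ge0 k0 (sqr_ge0 (s - t)); lra.
pose g1 x b y a := w x y * w x a * w b y * w b a / (u x * v y) ^+ 2.
pose g2 x b y a := w x y * w x a * w b y * w b a / (u b * v a) ^+ 2.
have s1 : \sum_x \sum_b \sum_y \sum_a g1 x b y a = \sum_x \sum_y w x y * quads x y / (u x * v y) ^+ 2.
  apply: eq_bigr => x _; rewrite exchange_big /=; apply: eq_bigr => y _.
  rewrite /quads mulr_sumr mulr_suml; apply: eq_bigr => b _.
  by rewrite mulr_sumr mulr_suml; apply: eq_bigr => a _; rewrite /g1; ring.
have s2 : \sum_x \sum_b \sum_y \sum_a g2 x b y a = \sum_x \sum_b \sum_y \sum_a g1 x b y a.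
  rewrite exchange_big /=; apply: eq_bigr => b _; apply: eq_bigr => x _.
  rewrite exchange_big /=; apply: eq_bigr => a _; apply: eq_bigr => y _.
  by rewrite /g1 /g2; ring.
apply: le_trans (_ : \sum_x \sum_b \sum_y \sum_a (g1 x b y a + g2 x b y a) / 2%:R <= _).
  by apply: ler_sum => x _; apply: ler_sum => b _; apply: ler_sum => y _; apply: ler_sum => a _; apply: amgm.
have -> : \sum_x \sum_b \sum_y \sum_a (g1 x b y a + g2 x b y a) / 2%:R =
    (\sum_x \sum_b \sum_y \sum_a g1 x b y a + \sum_x \sum_b \sum_y \sum_a g2 x b y a) / 2%:R.
  rewrite -big_split mulr_suml; apply: eq_bigr => x _.
  rewrite -big_split mulr_suml; apply: eq_bigr => b _.
  rewrite -big_split mulr_suml; apply: eq_bigr => y _.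
  by rewrite -big_split mulr_suml.
rewrite s2 s1; lra.
Qed.

(** Divided by [(u x * v y) ^+ 2], the main term of [quads_le] is 1 per edge and sums to [e].
    Another term is [u x / v y ^+ 2], at most [n1 / v y ^+ 2]; since [v y ^+ 3] edges meet [y],
    these sum to at most [n1 * T], and so does the symmetric term. *)
Lemma edges_le : e ^+ 4 <= T ^+ 4 * (K * (n1 * T *+ 2 + e)).
Proof.
apply: le_trans edges_le_Q _; apply: ler_wpM2l; first exact: exprn_ge0.
apply: le_trans Q_le _.
apply: le_trans (_ : \sum_x \sum_y K * (n1 * (w x y / v y ^+ 2) + n1 * (w x y / u x ^+ 2) + w x y) <= _).
  apply: ler_sum => x _; apply: ler_sum => y _.
  have [w0|w0] := eqVneq (w x y) 0; first by rewrite w0 !mul0r !mulr0 !addr0 mulr0.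
  have mxy : m x y by move: w0; rewrite /w pnatr_eq0 eqb0 negbK.
  have -> : w x y = 1 by rewrite /w mxy.
  have u0 := w_u w0; have v0 := w_v w0.
  rewrite mul1r ler_pdivrMr ?exprn_gt0 ?mulr_gt0 //.
  apply: le_trans (quads_le mxy) _; rewrite -[leRHS]mulrA; apply: ler_wpM2l => //.
  have -> : (n1 * (1 / v y ^+ 2) + n1 * (1 / u x ^+ 2) + 1) * (u x * v y) ^+ 2 =
      n1 * u x ^+ 2 + n1 * v y ^+ 2 + u x ^+ 2 * v y ^+ 2.
    by field; rewrite !gt_eqF.
  by rewrite lerD2r; apply: lerD; rewrite exprS; apply: ler_wpM2r => //; apply: exprn_ge0.
have sumE (f : A -> B -> R) : \sum_x \sum_y K * f x y = K * \sum_x \sum_y f x y.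
  by rewrite mulr_sumr; apply: eq_bigr => x _; rewrite mulr_sumr.
rewrite sumE; apply: ler_wpM2l => //.
have -> : \sum_x \sum_y (n1 * (w x y / v y ^+ 2) + n1 * (w x y / u x ^+ 2) + w x y) =
    n1 * (\sum_y \sum_x w x y / v y ^+ 2) + n1 * (\sum_x \sum_y w x y / u x ^+ 2) + e.
  rewrite [X in n1 * X + _]exchange_big !mulr_sumr -!big_split /=; apply: eq_bigr => x _.
  by rewrite !mulr_sumr -!big_split.
have cube (z : R) : z ^+ 3 / z ^+ 2 = z.
  by have [->|z0] := eqVneq z 0; [rewrite expr0n mul0r|field].
have -> : \sum_y \sum_x w x y / v y ^+ 2 = \sum_y v y.
  by apply: eq_bigr => y _; rewrite -mulr_suml -v_cube cube.
have -> : \sum_x \sum_y w x y / u x ^+ 2 = \sum_x u x.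
  by apply: eq_bigr => x _; rewrite -mulr_suml -u_cube cube.
by rewrite lerD2r mulr2n; apply: lerD; apply: ler_wpM2l.
Qed.
End QuadCount.

Lemma eq_ler (R : numDomainType) (x y : R) : x = y -> x <= y.
Proof. by move=> ->. Qed.

Section EdgeBound.
Variables (R : realFieldType) (phi : nat -> R).
Hypotheses (phi_ge0 : forall d, 0 <= phi d) (phi_cube : forall d, phi d ^+ 3 = d%:R).

Lemma phi_le d d' : (d <= d')%N -> phi d <= phi d'.
Proof. by move=> h; rewrite -(@ler_pXn2r _ 3) ?nnegrE // !phi_cube ler_nat. Qed.

Lemma phi_sum (J : finType) (d : J -> nat) n : (#|J| <= n)%N ->
  \sum_j phi (d j) <= phi (n ^ 2 * \sum_j d j).
Proof.
move=> Jn; set e := (\sum_j d j)%N; set T := phi _.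
have T3 : T ^+ 3 = n%:R ^+ 2 * e%:R by rewrite phi_cube natrM natrX.
have [e0|e0] := posnP e.
  rewrite big1 ?phi_ge0 // => j _.
  move/eqP: e0; rewrite sum_nat_eq0 => /forallP/(_ j)/implyP/(_ isT)/eqP dj.
  have : phi (d j) ^+ 3 == 0 by rewrite phi_cube dj.
  by rewrite expf_eq0 => /eqP.
have n0 : (0 < n)%N.
  apply: leq_trans Jn; rewrite lt0n; apply: contraTneq e0 => J0.
  rewrite -leqNgt leqn0 /e big1 // => j _; have := fintype0 j; rewrite J0 => /(_ erefl) [].
have n0' : 0 < n%:R :> R by rewrite ltr0n.
have e0' : 0 < e%:R :> R by rewrite ltr0n.
have T0 : 0 < T.
  have : T ^+ 3 != 0 by rewrite T3 mulf_neq0 ?expf_neq0 ?gt_eqF.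
  by rewrite expf_eq0 lt0r phi_ge0 andbT.
(* [t ^+ 3] equals [e / n], and [amgm] is the tangent line to the cube root at this point. *)
pose t := T / n%:R.
have t0 : 0 < t by rewrite divr_gt0.
have Tt : T = n%:R * t by rewrite /t mulrC divfK ?gt_eqF.
have e3 : e%:R = n%:R * t ^+ 3.
  have : n%:R ^+ 2 * (n%:R * t ^+ 3) = n%:R ^+ 2 * e%:R by rewrite -T3 Tt; ring.
  by move/mulfI => -> //; rewrite expf_neq0 ?gt_eqF.
have amgm j : phi (d j) * (3%:R * t ^+ 2) <= (d j)%:R + 2%:R * t ^+ 3.
  rewrite -(phi_cube (d j)); set s := phi (d j).
  have h : 0 <= (s - t) ^+ 2 * (s + 2%:R * t).
    by rewrite mulr_ge0 ?sqr_ge0 // addr_ge0 ?phi_ge0 // mulr_ge0 // ltW.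
  rewrite -subr_ge0; congr (0 <= _): h; ring.
rewrite -(ler_pM2r (_ : 0 < 3%:R * t ^+ 2)); last by rewrite mulr_gt0 ?exprn_gt0 ?ltr0n.
rewrite mulr_suml; apply: le_trans (_ : \sum_j ((d j)%:R + 2%:R * t ^+ 3) <= _).
  by apply: ler_sum => j _; apply: amgm.
rewrite big_split /= -natr_sum -/e e3 sumr_const Tt.
apply: le_trans (_ : n%:R * t ^+ 3 + 2%:R * t ^+ 3 *+ n <= _).
  by rewrite lerD2l ler_wpMn2l // mulr_ge0 ?exprn_ge0 ?ltW.
by rewrite -mulr_natr; apply: eq_ler; ring.
Qed.

Variables (A B TT : finType) (m : A -> B -> bool) (F : A -> B -> TT -> A -> B -> bool).
Variable n : nat.
Hypotheses (cardA : (#|A| <= n)%N) (cardB : (#|B| <= n)%N) (cardT : #|TT| = 16).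
Hypothesis F_cover : forall x y b a, m x y -> m x a -> m b y -> m b a ->
  a != y -> b != x -> exists t, F x y t b a.
Hypothesis F_in : forall x y t b a, F x y t b a -> m b y /\ m x a.
Hypothesis F_no_C4 : forall x y t b b' a a', m x y -> b != b' -> a != a' ->
  F x y t b a -> F x y t b a' -> F x y t b' a -> F x y t b' a' -> False.
Hypothesis F_no_C6 : forall x y t b1 b2 b3 a1 a2 a3, m x y ->
  b1 != b2 -> b1 != b3 -> b2 != b3 -> a1 != a2 -> a1 != a3 -> a2 != a3 ->
  F x y t b1 a2 -> F x y t b1 a3 -> F x y t b2 a1 -> F x y t b2 a3 ->
  F x y t b3 a1 -> F x y t b3 a2 -> False.

Let dA x := (\sum_y m x y)%N.
Let dB y := (\sum_x m x y)%N.

Let sum_card (X : finType) (P : pred X) : (\sum_x (P x : nat) = #|[set x | P x]|)%N.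
Proof. by rewrite -sum1_card [RHS]big_mkcond; apply: eq_bigr => x _; rewrite inE; case: (P x). Qed.

(** Here 129 is [16 * 8 + 1]: each of the 16 classes obeys [girth_eight_edges], and the degenerate
    cases [b = x] and [a = y] add the degrees of [x] and [y]. *)
Lemma quads_le x y : m x y ->
  \sum_b \sum_a (m x a)%:R * (m b y)%:R * (m b a)%:R <=
  129%:R * (phi (dA x) ^+ 3 + phi (dB y) ^+ 3 + phi (dA x) ^+ 2 * phi (dB y) ^+ 2).
Proof.
move=> mxy.
pose E t := (\sum_b \sum_a F x y t b a)%N.
have h : (\sum_b \sum_a (m x a * m b y * m b a) <= dA x + dB y + \sum_t E t)%N.
  apply: leq_trans (_ : \sum_b \sum_a ((b == x) * m x a + (a == y) * m b y + \sum_t F x y t b a) <= _)%N.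
    apply: leq_sum => b _; apply: leq_sum => a _.
    case xa: (m x a) => //; case by_: (m b y) => //; case ba: (m b a) => //.
    have [|bx] := eqVneq b x => //; have [|ay] := eqVneq a y => //=.
    have [t ht] := F_cover mxy xa by_ ba ay bx.
    by rewrite (bigD1 t) //= ht.
  under eq_bigr => b _ do rewrite !big_split /=.
  rewrite !big_split /=; apply: leq_add; last first.
    rewrite leq_eqVlt; apply/orP; left; apply/eqP; rewrite /E [RHS]exchange_big /=.
    by apply: eq_bigr => b _; rewrite exchange_big.
  apply: leq_add.
    rewrite (bigD1 x) //= [X in (_ + X)%N]big1 ?addn0 => [|b /negPf bx].
      by rewrite /dA; apply: leq_sum => a _; rewrite eqxx mul1n.
    by rewrite big1 // => a _; rewrite bx.
  rewrite /dB; apply: leq_sum => b _; rewrite (bigD1 y) //= eqxx mul1n big1 ?addn0 // => a /negPf ay.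
  by rewrite ay.
have cardA' : #|[set a | m x a]| = dA x by rewrite /dA sum_card.
have cardB' : #|[set b | m b y]| = dB y by rewrite /dB sum_card.
have hE t : (E t)%:R <= 8%:R * (phi (dA x) ^+ 3 + phi (dB y) ^+ 3) + 6%:R * (phi (dA x) ^+ 2 * phi (dB y) ^+ 2).
  have inF u v : F x y t u v -> u \in [set b | m b y] /\ v \in [set a | m x a].
    by move/F_in; rewrite !inE.
  have c4 u u' v v' := @F_no_C4 x y t u u' v v' mxy.
  have c6 u1 u2 u3 v1 v2 v3 := @F_no_C6 x y t u1 u2 u3 v1 v2 v3 mxy.
  have u0 := phi_ge0 (dA x); have v0 := phi_ge0 (dB y).
  have u3 : 0 <= phi (dA x) ^+ 3 by rewrite exprn_ge0.
  have v3 : 0 <= phi (dB y) ^+ 3 by rewrite exprn_ge0.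
  have uv : 0 <= phi (dA x) ^+ 2 * phi (dB y) ^+ 2 by rewrite mulr_ge0 ?exprn_ge0.
  case: (girth_eight_edges inF c4 c6); rewrite -/(E t) ?cardA' ?cardB'.
  - by rewrite -(ler_nat R) natrM -(phi_cube (dB y)); lra.
  - by rewrite -(ler_nat R) natrM -(phi_cube (dA x)); lra.
  rewrite -(ler_nat R) natrX natrM natrX natrM -(phi_cube (dA x)) -(phi_cube (dB y)) => hc.
  (* 6 is the least integer whose cube is at least 128. *)
  apply: le_trans (_ : 6%:R * (phi (dA x) ^+ 2 * phi (dB y) ^+ 2) <= _); last by lra.
  rewrite -(@ler_pXn2r _ 3) ?nnegrE ?ler0n // ?mulr_ge0 ?ler0n //.
  apply: le_trans hc _; rewrite [leRHS]exprMn.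
  have -> : (phi (dB y) ^+ 3 * phi (dA x) ^+ 3) ^+ 2 = (phi (dA x) ^+ 2 * phi (dB y) ^+ 2) ^+ 3 by ring.
  by apply: ler_wpM2r; [rewrite exprn_ge0|rewrite -natrX ler_nat].
have -> : \sum_b \sum_a (m x a)%:R * (m b y)%:R * (m b a)%:R =
    (\sum_b \sum_a (m x a * m b y * m b a))%:R :> R.
  rewrite natr_sum; apply: eq_bigr => b _; rewrite natr_sum; apply: eq_bigr => a _.
  by rewrite !natrM.
move: h; rewrite -(ler_nat R) => /le_trans; apply.
rewrite !natrD natr_sum -(phi_cube (dA x)) -(phi_cube (dB y)).
have : \sum_t (E t)%:R <= 16%:R * (8%:R * (phi (dA x) ^+ 3 + phi (dB y) ^+ 3) +
    6%:R * (phi (dA x) ^+ 2 * phi (dB y) ^+ 2)).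
  apply: le_trans (ler_sum _ (fun t _ => hE t)) _.
  by rewrite sumr_const cardT [16%:R * _]mulr_natl.
have uv : 0 <= phi (dA x) ^+ 2 * phi (dB y) ^+ 2 by rewrite mulr_ge0 ?exprn_ge0.
lra.
Qed.

Lemma edge_bound : ((\sum_x \sum_y m x y) ^ 5 <= 258 ^ 3 * n ^ 8)%N.
Proof.
set e := (\sum_x \sum_y m x y)%N.
pose T := phi (n ^ 2 * e); pose n1 := phi n.
have eB : e = (\sum_y dB y)%N by rewrite /e exchange_big.
have dA_le x : (dA x <= n)%N by rewrite /dA sum_card; apply: leq_trans (max_card _) cardB.
have dB_le y : (dB y <= n)%N by rewrite /dB sum_card; apply: leq_trans (max_card _) cardA.
have cA x : phi (dA x) ^+ 3 = \sum_y (m x y)%:R by rewrite phi_cube natr_sum.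
have cB y : phi (dB y) ^+ 3 = \sum_x (m x y)%:R by rewrite phi_cube natr_sum.
have sA : \sum_x phi (dA x) <= T by apply: phi_sum.
have sB : \sum_y phi (dB y) <= T by rewrite /T eB; apply: phi_sum.
have := edges_le (phi_ge0 n) (fun x => phi_ge0 (dA x)) (fun y => phi_ge0 (dB y)) cA cB
  (fun x => phi_le (dA_le x)) (fun y => phi_le (dB_le y)) sA sB (ler0n _ 129) quads_le.
have -> : \sum_x \sum_y (m x y)%:R = e%:R :> R.
  by rewrite natr_sum; apply: eq_bigr => x _; rewrite natr_sum.
rewrite -/n1.
have [->|e0] := posnP e; first by [].
have e0' : 0 < e%:R :> R by rewrite ltr0n.
have T3 : T ^+ 3 = n%:R ^+ 2 * e%:R by rewrite phi_cube natrM natrX.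
have n3 : n1 ^+ 3 = n%:R by rewrite phi_cube.
have T0 : 0 <= T := phi_ge0 _; have n0 : 0 <= n1 := phi_ge0 _.
move=> main; rewrite -(ler_nat R) natrX natrM !natrX.
(* If [e] dominates, [e^3 <= 258 T^4], and cubing gives [e^9 <= 258^3 n^8 e^4]. Otherwise
   [e^2 <= 8 n^3], which suffices together with [e <= n^2]. *)
have [big|small] := lerP (n1 * T *+ 2) e%:R.
  have h3 : e%:R ^+ 3 <= 258%:R * T ^+ 4.
    rewrite -(ler_pM2r e0') -exprSr; apply: le_trans main _.
    have -> : 258%:R * T ^+ 4 * e%:R = T ^+ 4 * (258%:R * e%:R) by ring.
    by apply: ler_wpM2l; [apply: exprn_ge0|lra].
  have h9 : (e%:R ^+ 3) ^+ 3 <= (258%:R * T ^+ 4) ^+ 3.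
    by rewrite ler_pXn2r ?nnegrE ?mulr_ge0 ?exprn_ge0 ?ler0n.
  rewrite -(ler_pM2r (_ : 0 < e%:R ^+ 4)); last by rewrite exprn_gt0.
  have -> : e%:R ^+ 5 * e%:R ^+ 4 = (e%:R ^+ 3) ^+ 3 :> R by ring.
  apply: le_trans h9 _; rewrite exprMn -exprM.
  have -> : T ^+ (4 * 3) = (T ^+ 3) ^+ 4 by rewrite -exprM.
  by rewrite T3; apply: eq_ler; ring.
have small3 : e%:R ^+ 3 < 8%:R * n%:R ^+ 3 * e%:R :> R.
  have : e%:R ^+ 3 < (n1 * T *+ 2) ^+ 3.
    by rewrite ltr_pXn2r ?nnegrE ?mulrn_wge0 ?mulr_ge0 ?ler0n.
  move/lt_le_trans; apply; rewrite -mulr_natl !exprMn n3 T3.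
  by apply: eq_ler; ring.
have small2 : e%:R ^+ 2 <= 8%:R * n%:R ^+ 3 :> R.
  by rewrite ltW // -(ltr_pM2r e0') -exprSr.
have en : e%:R <= n%:R ^+ 2 :> R.
  rewrite -natrX ler_nat /e; apply: leq_trans (_ : \sum_(x : A) n <= _)%N.
    by apply: leq_sum => x _; apply: dA_le.
  by rewrite sum_nat_const -mulnn leq_mul2r cardA orbT.
have -> : e%:R ^+ 5 = (e%:R ^+ 2) ^+ 2 * e%:R :> R by ring.
apply: le_trans (_ : (8%:R * n%:R ^+ 3) ^+ 2 * n%:R ^+ 2 <= _).
  apply: ler_pM => //; rewrite ?exprn_ge0 ?exprn_even_ge0 //.
  by rewrite ler_pXn2r ?nnegrE ?mulr_ge0 ?exprn_ge0 ?ler0n.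
have -> : (8%:R * n%:R ^+ 3) ^+ 2 * n%:R ^+ 2 = 64%:R * n%:R ^+ 8 :> R by ring.
by apply: ler_wpM2r; [rewrite exprn_ge0|rewrite -natrX ler_nat].
Qed.
End EdgeBound.

Section GridBound.
Variable R : realType.

Definition cube_root (d : nat) : R := d%:R `^ 3^-1.

Lemma cube_root_ge0 d : 0 <= cube_root d.
Proof. exact: powR_ge0. Qed.

Lemma cube_root_cube d : cube_root d ^+ 3 = d%:R.
Proof. by rewrite /cube_root -powR_mulrn ?powR_ge0 // -powRrM mulVf ?pnatr_eq0 // powRr1 ?ler0n. Qed.

Lemma grid_bound (I : finType) (s1 s2 p1 p2 : I -> nat) n :
  exchange_free s1 s2 p1 p2 -> injective p1 -> injective p2 ->
  (forall i, s1 i < n)%N -> (forall i, s2 i < n)%N ->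
  (#|I| <= n ^ 2)%N /\ (#|I| ^ 5 <= 258 ^ 3 * n ^ 8)%N.
Proof.
move=> ex i1 i2 b1 b2.
pose f i := (Ordinal (b1 i), Ordinal (b2 i)).
have fi : injective f by move=> i j [h1 h2]; apply: (segments_determine ex).
split; first by rewrite -mulnn -[X in (_ <= X * X)%N](card_ord n) -card_prod; apply: leq_card fi.
case: (pickP I) => [i0 _|I0]; last by rewrite eq_card0.
pose m (x y : 'I_n) := occupied s1 s2 x y.
have cover : (#|I| <= \sum_x \sum_y m x y)%N.
  rewrite -(card_imset _ fi) -sum1_card big_mkcond /= pair_big /=; apply: leq_sum => -[x y] _.
  case: ifP => // /imsetP[i _ [-> ->]]; rewrite lt0b /m /occupied.
  by apply/existsP; exists i; rewrite !eqxx.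
apply: leq_trans (_ : (\sum_x \sum_y m x y) ^ 5 <= _)%N; first by rewrite leq_exp2r.
pose F (x y : 'I_n) t (b a : 'I_n) := link s1 s2 p1 p2 i0 x y t b a.
apply: (@edge_bound R cube_root cube_root_ge0 cube_root_cube _ _
  ((bool * bool) * (bool * bool))%type m F n); rewrite ?card_ord //.
- by rewrite !card_prod card_bool.
- move=> x y b a mxy mxa mby mba ay bx; exists (quad_type s1 s2 p1 p2 i0 x y b a).
  by rewrite /F /link [occupied _ _ b a]mba [occupied _ _ x a]mxa [occupied _ _ b y]mby ay bx eqxx.
- by move=> x y t b a /linkP[[]].
- by move=> x y t b b' a a' mxy bb aa; apply: (link_no_C4 ex i1 i2 bb aa).
- by move=> x y t u1 u2 u3 v1 v2 v3 mxy h1 h2 h3 h4 h5 h6; apply: (link_no_C6 ex i1 i2 mxy h1 h2 h3 h4 h5 h6).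
Qed.
End GridBound.

Theorem theorem1p3 (R : realType) :
  exists C : R, 0 < C /\
    forall r : nat, (2 <= r)%N ->
    forall (T : finType) (e : rel T),
      simple_graph e -> r_connected r e ->
    forall c1 c2 : seq T, longest_cycle e c1 -> longest_cycle e c2 ->
      C * (r%:R `^ (5%:R / 8%:R)) <= #|[set x in c1] :&: [set x in c2]|%:R.
Proof.
(* [K] is kept without a body because its unary value is too large to be unfolded. *)
have [K KE] : exists K, K = (32 * (258 ^ 3 * 2 ^ 8))%N by eexists.
have K0 : 0 < K%:R :> R by rewrite ltr0n KE !muln_gt0.
(* With this constant the eighth power of the claim is [r ^ 5 <= K * s ^ 8]. *)
exists (K%:R `^ (- 8%:R^-1)); split; first exact: powR_gt0.
move=> r r2 T e sg rc c1 c2 lc1 lc2; set s := #|_|.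
have [u1 cy1] := longest_uniq_cycle lc1; have [u2 cy2] := longest_uniq_cycle lc2.
have [I [a [b [mid [lk rI]]]]] := linkage_exists sg rc r2 lc1 lc2.
have ex := longest_exchange_free (proj1 sg) u1 u2 cy1 cy2 (longest_max lc1) (longest_max lc2) lk.
have i1 : injective (fun i => index (a i) c1).
  move=> i j h; apply: (link_src_inj lk).
  have [ai _] := link_src lk i; have [aj _] := link_src lk j.
  by rewrite -(nth_index (a i) ai) h nth_index.
have i2 : injective (fun i => index (b i) c2).
  move=> i j h; apply: (link_dst_inj lk).
  have [bi _] := link_dst lk i; have [bj _] := link_dst lk j.
  by rewrite -(nth_index (b i) bi) h nth_index.
(* [s] common vertices cut a list, unlike a cycle, into [s + 1] segments. *)
have b1 i : (seg c1 c2 (a i) < s.+1)%N by rewrite ltnS; apply: seg_le_common.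
have b2 i : (seg c2 c1 (b i) < s.+1)%N by rewrite ltnS /s setIC; apply: seg_le_common.
have [small big] := @grid_bound R I _ _ _ _ s.+1 ex i1 i2 b1 b2.
(* Without common vertices each cycle is one segment, which allows at most one path, against
   [r >= 2]. *)
have s0 : (0 < s)%N.
  by rewrite lt0n; apply/eqP => s0; move: rI small; rewrite -/s s0 addn0 => rI; rewrite leqNgt (leq_trans r2 rI).
(* [r] is at most twice the larger of [#|I|] and [s], whence [32 = 2^5]; the factor [2^8] comes from
   [s + 1 <= 2 s]. *)
have r5 : (r ^ 5 <= K * s ^ 8)%N.
  have [tS|st] := leqP #|I| s.
    apply: leq_trans (_ : (2 * s) ^ 5 <= _)%N.
      by rewrite leq_exp2r // mul2n -addnn; apply: leq_trans rI _; rewrite leq_add2r.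
    rewrite expnMn; apply: leq_mul; first by rewrite KE -[X in (X <= _)%N]muln1 leq_mul2l !muln_gt0.
    by rewrite leq_pexp2l.
  apply: leq_trans (_ : (2 * #|I|) ^ 5 <= _)%N.
    by rewrite leq_exp2r // mul2n -addnn; apply: leq_trans rI _; rewrite leq_add2l ltnW.
  rewrite expnMn KE -[X in (_ <= X)%N]mulnA; apply: leq_mul => //.
  apply: leq_trans big _; rewrite -[X in (_ <= X)%N]mulnA leq_mul2l -expnMn leq_exp2r //.
  by apply/orP; right; rewrite mul2n -addnn -addn1 leq_add2l.
rewrite -(@ler_pXn2r _ 8) ?nnegrE ?mulr_ge0 ?powR_ge0 ?ler0n // exprMn.
rewrite -!powR_mulrn ?powR_ge0 ?ler0n // -!powRrM mulNr mulVf ?pnatr_eq0 // divfK ?pnatr_eq0 //.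
rewrite powRN powRr1 ?ler0n // !powR_mulrn ?ler0n // mulrC ler_pdivrMr // mulrC.
by rewrite -!natrX -natrM ler_nat.
Qed.
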